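(* There exist absolute constants $c>0$ and $n_0$ such that for every $n\ge n_0$ and every metric space $M$ on $n$ points, if a randomized online algorithm for the metrical task system on $M$ is $r$-competitive against oblivious adversaries, then $r\ge c\,\frac{\log n}{(\log\log n)^2}$. That is, the randomized competitive ratio of the MTS problem on any $n$-point metric space is $\Omega(\log n/\log^2\log n)$.
   Context: Metrical task system (MTS) on a finite metric space $(V,d)$ with $V=\{v_1,\dots,v_b\}$: an algorithm occupies a point of $V$ (starting from a given initial point) and receives a sequence of tasks, each a vector $(c_1,\dots,c_b)\in(\mathbb{R}_{\ge0}\cup\{\infty\})^b$. When at $v_i$ and given a task, the algorithm may move to some $v_j$, paying $d(v_i,v_j)+c_j$; the cost of a task sequence $\sigma$ is the sum of these costs. An online algorithm decides based only on tasks seen so far; a randomized online algorithm may use random bits. $\mathrm{cost}_{\mathrm{OPT}}(\sigma)$ is the minimum cost of any offline algorithm starting at the initial point and serving $\sigma$. A randomized online algorithm $A$ is $r$-competitive against oblivious adversaries if there is a constant $c'$ with $\mathbb{E}[\mathrm{cost}_A(\sigma)]\le r\,\mathrm{cost}_{\mathrm{OPT}}(\sigma)+c'$ for every task sequence $\sigma$. *)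

(* Defs.v *)
From HB Require Import structures.
From mathcomp Require Import all_boot all_order all_algebra.
From mathcomp Require Import all_classical all_reals all_analysis.

Set Implicit Arguments.
Unset Strict Implicit.
Unset Printing Implicit Defensive.

Import Order.TTheory GRing.Theory Num.Theory.

Local Open Scope classical_set_scope.
Local Open Scope ring_scope.

(* Instances over any finType are obtained from a distance function by the
   factory [isMetric]. *)
#[short(type="finMetricType")]
HB.structure Definition FinMetric (R : numDomainType) :=
  { M of Finite M & Metric R M }.

Definition task (R : realType) (M : finMetricType R) : Type :=
  M -> {nonneg \bar R}.

(* [serve_cost x s p] is the cost of serving [s] from [x] when the i-th task is
   served at the i-th point of [p]; only used with [size p = size s]. *)
Fixpoint serve_cost (R : realType) (M : finMetricType R) (x : M)
    (s : seq (task M)) (p : seq M) : \bar R :=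
  match s, p with
  | c :: s', y :: p' => ((mdist x y)%:E + (c y)%:num + serve_cost y s' p')%E
  | _, _ => 0%E
  end.

Definition cost_opt (R : realType) (M : finMetricType R) (v0 : M)
    (s : seq (task M)) : \bar R :=
  \big[Order.min/+oo%E]_(p : (size s).-tuple M) serve_cost v0 s p.

(* The random bits are a point [w] of the probability space. [position w s] is
   the point occupied once all of [s] has been served; as it may depend only on
   [w] and [s], decisions are online. *)
Record randomized_online_algorithm (R : realType) (M : finMetricType R)
    (v0 : M) (d : measure_display) (Omega : measurableType d) := {
  position : Omega -> seq (task M) -> M;
  position_nil : forall w, position w [::] = v0;
  measurable_position : forall (s : seq (task M)) (v : M),
    measurable [set w | position w s = v] }.

Definition cost_alg (R : realType) (M : finMetricType R) (v0 : M)
    (d : measure_display) (Omega : measurableType d)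
    (A : randomized_online_algorithm v0 Omega) (s : seq (task M)) (w : Omega) :
    \bar R :=
  serve_cost v0 s [seq position A w (take i.+1 s) | i <- iota 0 (size s)].

Definition competitive (R : realType) (M : finMetricType R) (v0 : M)
    (d : measure_display) (Omega : measurableType d) (P : probability Omega R)
    (A : randomized_online_algorithm v0 Omega) (r : R) : Prop :=
  exists c' : R, forall s : seq (task M),
    (\int[P]_w cost_alg A s w <= r%:E * cost_opt v0 s + c'%:E)%E.

(* Main.v *)
Require Import Defs.
From HB Require Import structures.
From mathcomp Require Import all_boot all_order all_algebra.
From mathcomp Require Import all_classical all_reals all_analysis.
From mathcomp Require Import measurable_realfun ring lra zify.

Set Implicit Arguments.
Unset Strict Implicit.
Unset Printing Implicit Defensive.

Import Order.TTheory GRing.Theory Num.Theory.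

Local Open Scope ring_scope.

(* A randomized request sequence is a game tree whose branchings are fair coins.
   On a single point, charging that point makes an online and an offline player
   pay the same. Given well separated clusters carrying such games, let each
   cluster be played again and again, each time with probability 1/2: all
   positions are equally bad for an online player, but an offline player can
   pick a cluster that was hit rarely. By anti-concentration of the binomial
   law, this increases the ratio of a cluster of weight [k1] by about
   [log (1 + m^2 k2 / k1)] when there are [m] other clusters of weight [k2], so
   that, up to constants and a factor [log log n] due to the distortion, the
   ratio is the logarithm of the total weight.
   A ball-growing argument splits [P] into parts [P1], [P2] at distance
   [diam P / O(log log n)] with [sqrt #|P1| + sqrt #|P2| >= sqrt #|P|]. The game
   only works if consecutive scales differ by a factor [2 ^ tau], with
   [tau = O(log log n)]; so the scales are treated modulo [tau]: for each residue,
   a split at a scale of that residue adds the weights, any other keeps the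
   heavier part. The product of the [tau] resulting weights is at least
   [sqrt n], hence one of them has logarithm at least [log n / (2 tau)]. *)

(** * Games against an online algorithm *)

Section Games.
Variables (R : realType) (M : finMetricType R).
Implicit Types (U S : {set M}) (phi psi chi : M -> R) (x y z : M) (v : R).

(* [Play z v g]: a task costing [v] at [z] and nothing elsewhere, then [g];
   [Flip g g']: a fair coin decides between [g] and [g']. *)
Inductive game := Stop | Play of M & R & game | Flip of game & game.

Implicit Types g : game.

Fixpoint seqg g g' :=
  match g with
  | Stop => g'
  | Play z v h => Play z v (seqg h g')
  | Flip h k => Flip (seqg h g') (seqg k g')
  end.

Lemma seqgA g1 g2 g3 : seqg g1 (seqg g2 g3) = seqg (seqg g1 g2) g3.
Proof. by elim: g1 => //= [z v g ->|g -> h ->]. Qed.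

(** [game] puts no sign condition on the values it carries; the absolute value makes each of them a
    legitimate cost. *)
Definition pcost (a : M * R) x : R := if x == a.1 then `|a.2| else 0.

Lemma pcost_ge0 a x : 0 <= pcost a x.
Proof. by rewrite /pcost; case: ifP. Qed.

(* [lower U phi g psi]: an online player confined to [U], who is told the coins
   as they are flipped and pays [phi] at its final position, has expected cost
   at least [psi x] from [x]. *)
Fixpoint lower U phi g psi : Prop :=
  match g with
  | Stop => {in U, forall x, psi x <= phi x}
  | Play z v h => exists2 chi, lower U phi h chi &
      {in U &, forall x y, psi x <= mdist x y + pcost (z, v) y + chi y}
  | Flip h k => exists chi1 chi2, [/\ lower U phi h chi1, lower U phi k chi2 &
      {in U, forall x, psi x <= (chi1 x + chi2 x) / 2}]
  end.

Lemma lower_le U phi g psi psi' : {in U, forall x, psi' x <= psi x} ->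
  lower U phi g psi -> lower U phi g psi'.
Proof.
move=> le_psi; case: g => [|z v h|h k] /=.
- by move=> H x Ux; exact: le_trans (le_psi x Ux) (H x Ux).
- by move=> [chi Hc H]; exists chi => // x y Ux Uy;
    exact: le_trans (le_psi x Ux) (H x y Ux Uy).
- by move=> [c1 [c2 [H1 H2 H]]]; exists c1, c2; split=> // x Ux;
    exact: le_trans (le_psi x Ux) (H x Ux).
Qed.

Lemma lower_seq U phi chi psi g g' :
  lower U chi g psi -> lower U phi g' chi -> lower U phi (seqg g g') psi.
Proof.
move=> + Hg'; elim: g psi => [|z v h IH|h IH k IHk] psi /=.
- by move=> H; exact: lower_le H Hg'.
- by move=> [c Hc H]; exists c => //; exact: IH.
- by move=> [c1 [c2 [H1 H2 H]]]; exists c1, c2; split=> //; [exact: IH|exact: IHk].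
Qed.

Definition lip U phi := {in U &, forall x y, phi x <= phi y + mdist x y}.

Definition raise_on S v phi : M -> R := fun x => phi x + v * (x \in S)%:R.

(** The raised function at [y] is the task cost at [y] plus the later cost, so its Lipschitz
    property says exactly that moving before serving saves nothing. *)
Lemma lower_Play1 U phi z v : 0 <= v -> lip U (raise_on [set z] v phi) ->
  lower U phi (Play z v Stop) (raise_on [set z] v phi).
Proof.
move=> v0 L; exists phi => //= x y Ux Uy; have := L x y Ux Uy.
rewrite /raise_on /pcost !inE /= (ger0_norm v0).
by case: (y == z); case: (x == z); rewrite ?mulr1 ?mulr0; lra.
Qed.

(** * Expected offline cost *)

Fixpoint expect g (F : seq (M * R) -> R) : R :=
  match g with
  | Stop => F [::]
  | Play z v h => expect h (fun s => F ((z, v) :: s))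
  | Flip h k => (expect h F + expect k F) / 2
  end.

Lemma expect_le g F F' : (forall s, F s <= F' s) -> expect g F <= expect g F'.
Proof.
elim: g F F' => [|z v h IH|h IH k IHk] F F' le_F //=; first by apply: IH => s.
by rewrite ler_pM2r ?invr_gt0 // lerD // ?IH ?IHk.
Qed.

Lemma eq_expect g F F' : F =1 F' -> expect g F = expect g F'.
Proof. by move=> /funext ->. Qed.

Lemma expect_cst g c : expect g (fun=> c) = c.
Proof. by elim: g => //= h -> k ->; lra. Qed.

Lemma expectD g F F' :
  expect g (fun s => F s + F' s) = expect g F + expect g F'.
Proof.
by elim: g F F' => [|z v h IH|h IH k IHk] F F' //=; rewrite IH // IHk; lra.
Qed.

Lemma expect_half g F F' :
  expect g (fun s => (F s + F' s) / 2) = (expect g F + expect g F') / 2.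
Proof.
by elim: g F F' => [|z v h IH|h IH k IHk] F F' //=; rewrite IH // IHk; lra.
Qed.

Lemma expect_seq g g' F :
  expect (seqg g g') F = expect g (fun s => expect g' (fun s' => F (s ++ s'))).
Proof. by elim: g F => [|z v h IH|h IH k IHk] F //=; rewrite ?IH ?IHk. Qed.

Definition minover U x (F : M -> R) : R := F [arg min_(z < x in U) F z]%O.

Lemma minover_le U x F z : x \in U -> z \in U -> minover U x F <= F z.
Proof. by rewrite /minover => Ux Uz; case: arg_minP => // i _; apply. Qed.

Lemma minoverP U x F : x \in U -> exists2 z, z \in U & minover U x F = F z.
Proof. by rewrite /minover => Ux; case: arg_minP => // i Ui _; exists i. Qed.

(** The end point is prescribed and the way to it is charged, so that offline solutions of
    consecutive games can be glued at a common point. *)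
Fixpoint opt U x (s : seq (M * R)) y : R :=
  match s with
  | [::] => mdist x y
  | a :: s' => minover U x (fun z => mdist x z + pcost a z + opt U z s' y)
  end.

Lemma opt_triangle U x w s y : x \in U -> w \in U ->
  opt U x s y <= mdist x w + opt U w s y.
Proof.
move=> Ux Uw; case: s => [|a s] /=; first exact: metric_triangle.
have [z Uz ->] := minoverP (fun z => mdist w z + pcost a z + opt U z s y) Uw.
apply: le_trans (minover_le _ Ux Uz) _.
by have := metric_triangle x w z; lra.
Qed.

Lemma opt_cat U x w s s' y : x \in U -> w \in U ->
  opt U x (s ++ s') y <= opt U x s w + opt U w s' y.
Proof.
move=> Ux Uw; elim: s x Ux => [|a s IH] x Ux /=; first exact: opt_triangle.
have [z Uz ->] := minoverP (fun z => mdist x z + pcost a z + opt U z s w) Ux.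
by apply: le_trans (minover_le _ Ux Uz) _; have := IH z Uz; lra.
Qed.

Lemma opt_end U x s w y : x \in U -> w \in U ->
  opt U x s y <= opt U x s w + mdist w y.
Proof. by move=> Ux Uw; have := opt_cat s [::] y Ux Uw; rewrite cats0. Qed.

Definition off U g x y := expect g (fun s => opt U x s y).

Lemma off_seq U g g' x w y : x \in U -> w \in U ->
  off U (seqg g g') x y <= off U g x w + off U g' w y.
Proof.
move=> Ux Uw; rewrite /off expect_seq.
rewrite -[X in _ + X](expect_cst g) -expectD; apply: expect_le => s.
rewrite -[opt U x s w](expect_cst g') -expectD.
by apply: expect_le => s'; exact: opt_cat.
Qed.

(** A player at [x] may go to [w], serve everything from there and return at the end. *)
Lemma off_via U g x w : x \in U -> w \in U ->
  off U g x x <= off U g w w + 2 * mdist x w.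
Proof.
move=> Ux Uw; rewrite /off -[2 * _](expect_cst g) -expectD.
apply: expect_le => s; have := opt_triangle s x Ux Uw.
by have := opt_end s x Uw Uw; rewrite (metric_sym w x); lra.
Qed.

Lemma off_Stop U x : off U Stop x x = 0.
Proof. by rewrite /off /= mdistxx. Qed.

Lemma off_Play1 U z v x : x \in U ->
  off U (Play z v Stop) x x <= (x == z)%:R * `|v|.
Proof.
move=> Ux; rewrite /off /=; apply: le_trans (minover_le _ Ux Ux) _.
by rewrite !mdistxx /pcost /=; case: (x == z); rewrite ?mul1r ?mul0r; lra.
Qed.

End Games.

(** * Fair coins *)

Section Coins.
Variable R : realType.
Implicit Types (f g : nat -> R) (n a b q l : nat).

(* [headsE n f a] is the expectation of [f (a + B)] for [B] the number of heads
   among [n] fair coins. *)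
Fixpoint headsE n f a : R :=
  if n is n'.+1 then (headsE n' f a.+1 + headsE n' f a) / 2 else f a.

Lemma headsE_le n f g a : (forall b, f b <= g b) -> headsE n f a <= headsE n g a.
Proof.
move=> fg; elim: n a => //= n IH a.
by rewrite ler_pM2r ?invr_gt0 // lerD.
Qed.

Lemma headsE_cst n (c : R) a : headsE n (fun=> c) a = c.
Proof. by elim: n a => //= n IH a; rewrite !IH; lra. Qed.

Lemma headsED n f g a : headsE n (fun b => f b + g b) a = headsE n f a + headsE n g a.
Proof. by elim: n a => //= n IH a; rewrite !IH; lra. Qed.

Lemma headsEZ n (c : R) f a : headsE n (fun b => c * f b) a = c * headsE n f a.
Proof. by elim: n a => //= n IH a; rewrite !IH; lra. Qed.

Lemma headsE_add m n f a : headsE (m + n) f a = headsE m (headsE n f) a.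
Proof. by elim: m a => //= m IH a; rewrite !IH. Qed.

Lemma headsE_shift n f a b : headsE n f (a + b)%N = headsE n (fun c => f (c + b)%N) a.
Proof. by elim: n a => //= n IH a; rewrite -addSn !IH. Qed.

Lemma headsE_mean n a : headsE n (fun b => b%:R) a = a%:R + n%:R / 2.
Proof.
elim: n a => /= [|n IH] a; first by rewrite mul0r addr0.
rewrite !IH -(natr1 a) -(natr1 n); lra.
Qed.

Definition atmost (t : R) : nat -> R := fun b => (b%:R <= t)%R%:R.

Lemma atmost_ge0 t b : 0 <= atmost t b.
Proof. exact: ler0n. Qed.

Lemma headsE_atmost_ge0 n t a : 0 <= headsE n (atmost t) a.
Proof.
by rewrite -(headsE_cst n 0 a); apply: headsE_le => b; exact: atmost_ge0.
Qed.

(** Cut the coins into [q] independent blocks of [n]: it suffices that each block has at most [t]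
    heads. *)
Lemma headsE_atmost_mul n t (p : R) q : 0 <= p -> p <= headsE n (atmost t) 0 ->
  p ^+ q <= headsE (q * n) (atmost (q%:R * t)) 0.
Proof.
move=> p0 Hp; elim: q => [|q IH].
  by rewrite expr0 mul0n /= /atmost mul0r lexx.
rewrite mulSn headsE_add exprSr.
apply: le_trans (ler_wpM2l (exprn_ge0 q p0) Hp) _.
rewrite -headsEZ; apply: headsE_le => b.
rewrite {1}/atmost; case: (leP b%:R t) => [bt|_]; last first.
  by rewrite mulr0 headsE_atmost_ge0.
rewrite mulr1; apply: le_trans IH _.
rewrite -[X in _ <= headsE _ _ X]add0n headsE_shift; apply: headsE_le => c.
rewrite /atmost; case: (leP c%:R _) => // ct; rewrite ?ler0n //.
suff -> : (c + b)%:R <= q.+1%:R * t by rewrite lexx.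
by rewrite natrD -natr1 mulrDl mul1r lerD.
Qed.

Lemma headsE_all_miss n : 2^-1 ^+ n <= headsE n (atmost 0) 0.
Proof.
have := @headsE_atmost_mul 1 0 2^-1 n; rewrite mulr0 muln1; apply.
  by rewrite invr_ge0.
by rewrite /= /atmost lexx ler10 add0r mul1r.
Qed.

(** A coin changes [d] by -1 plus a random sign. Hence [d] ends as [e] plus a sum of [n] independent
    signs, whose second and fourth moments are [n] and [3 n^2 - 2 n] and whose odd moments
    vanish. *)
Lemma headsE_moments n (c0 c1 c2 c3 : R) a (k : R) :
  let d b := k - 2 * b%:R in
  headsE n (fun b => c0 + c1 * d b + c2 * d b ^+ 2 + c3 * d b ^+ 3 - d b ^+ 4) a
  = let e := d a - n%:R in
    c0 + c1 * e + c2 * (e ^+ 2 + n%:R) + c3 * (e ^+ 3 + 3 * e * n%:R)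
    - (e ^+ 4 + 6 * e ^+ 2 * n%:R + 3 * n%:R ^+ 2 - 2 * n%:R).
Proof.
move=> d; elim: n a => [|n IH] a /=; first by rewrite /d; ring.
by rewrite !IH /d /= -(natr1 a) -(natr1 n); field.
Qed.

(* Paley-Zygmund: for [Y = (l^2 - 2 b) / l], the quartic
   [(Y - 1/2) (4 - Y) (Y + 3/2)^2 / 100] is at most the indicator of [Y >= 1/2]
   and has expectation at least [1/64]. *)
Lemma headsE_deviation l : (0 < l)%N ->
  64^-1 <= headsE (l * l)%N (atmost ((l * l)%N%:R / 2 - l%:R / 4)) 0 :> R.
Proof.
move=> l0.
have L0 : 0 < l%:R :> R by rewrite ltr0n.
set L : R := l%:R in L0 *.
pose d (b : nat) : R := L ^+ 2 - 2 * b%:R.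
pose P y : R := (y - L / 2) * (4 * L - y) * (y + 3 / 2 * L) ^+ 2.
have step b : (100 * L ^+ 4)^-1 * P (d b) <= atmost (L ^+ 2 / 2 - L / 4) b.
  have D0 : 0 < 100 * L ^+ 4 by rewrite mulr_gt0 // exprn_gt0.
  rewrite mulrC ler_pdivrMr // /atmost /P.
  have sq0 := sqr_ge0 (d b + 3 / 2 * L).
  case: (leP b%:R _) => Hb; last first.
    have H : d b - L / 2 < 0 by rewrite /d; lra.
    by rewrite mul0r mulr_le0_ge0 // mulr_le0_ge0 //; lra.
  have H1 : 0 <= d b - L / 2 by rewrite /d; lra.
  rewrite mul1r; case: (leP (d b) (4 * L)) => H2; last first.
    by apply: le_trans (ltW D0); rewrite mulr_le0_ge0 // mulr_ge0_le0 //; lra.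
  have Q : (d b - L / 2) * (4 * L - d b) <= 49 / 16 * L ^+ 2.
    by have := sqr_ge0 (d b - 9 / 4 * L); nra.
  have Q0 : 0 <= (d b - L / 2) * (4 * L - d b) by rewrite mulr_ge0 // subr_ge0.
  have S : (d b + 3 / 2 * L) ^+ 2 <= 121 / 4 * L ^+ 2.
    have -> : 121 / 4 * L ^+ 2 = (11 / 2 * L) ^+ 2 by field.
    by rewrite lerXn2r ?nnegrE; lra.
  apply: le_trans (ler_pM Q0 sq0 Q S) _.
  have := exprn_gt0 4 L0; have -> : 49 / 16 * L ^+ 2 * (121 / 4 * L ^+ 2)
    = 5929 / 64 * L ^+ 4 by field.
  lra.
have L2 : (l * l)%N%:R = L ^+ 2 by rewrite natrM expr2.
rewrite L2; apply: le_trans (headsE_le (l * l)%N 0 step).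
rewrite headsEZ mulrC ler_pdivlMr ?mulr_gt0 ?exprn_gt0 //.
(* These are the coefficients of [P y] as a quartic in [y]; the offset [L ^+ 2] makes the mean [e]
   vanish. *)
have E := @headsE_moments (l * l)%N (- (9 / 2 * L ^+ 4)) (33 / 8 * L ^+ 3)
  (37 / 4 * L ^+ 2) (3 / 2 * L) 0 (L ^+ 2).
have -> : headsE (l * l)%N (fun b => P (d b)) 0 = 7 / 4 * L ^+ 4 + 2 * L ^+ 2.
  apply: etrans (etrans E _).
    by congr (headsE _ _ _); apply/funext => b; rewrite /P /d; field.
  by rewrite /= L2 mulr0; field.
have := exprn_gt0 4 L0; have := exprn_gt0 2 L0; lra.
Qed.

End Coins.

(** * Playing on well-separated clusters *)

Section Hits.
Variables (R : realType) (I : finType).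
Implicit Types (p h : seq I) (H : seq I -> R) (i j : I).

(* Expectation over the random subsequence [h] of [p] that keeps each entry
   with probability 1/2. *)
Fixpoint hitE p H : R :=
  if p is i :: p' then (hitE p' (fun h => H (i :: h)) + hitE p' H) / 2
  else H [::].

Lemma hitE_le p H H' : (forall h, H h <= H' h) -> hitE p H <= hitE p H'.
Proof.
elim: p H H' => //= i p IH H H' HH'.
by rewrite ler_pM2r ?invr_gt0 // lerD // IH.
Qed.

Lemma hitEDl p c H : hitE p (fun h => c + H h) = c + hitE p H.
Proof. by elim: p H => //= i p IH H; rewrite !IH; lra. Qed.

(** The hit counts of distinct entries are independent binomials. The offsets [n] record hits
    already made and carry the induction. *)
Lemma hitE_prod p (f : I -> nat -> R) (n : I -> nat) :
  hitE p (fun h => \prod_i f i (count_mem i h + n i)%N)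
  = \prod_i headsE (count_mem i p) (f i) (n i).
Proof.
elim: p n => [|i p IH] n /=; first by under eq_bigr do rewrite add0n.
rewrite IH; have -> : (fun h => \prod_j f j (((i == j) + count_mem j h) + n j)%N)
    = (fun h => \prod_j f j (count_mem j h + ((i == j) + n j))%N).
  by apply/funext => h; apply: eq_bigr => j _; rewrite [((i == j) + _)%N]addnC addnA.
rewrite (IH (fun j => ((i == j) + n j)%N)).
have bigi (G : I -> R) : \prod_j G j = G i * \prod_(j | j != i) G j.
  by rewrite (bigD1 i).
rewrite !bigi eqxx /= add1n.
rewrite [X in _ * X + _](eq_bigr (fun j => headsE (count_mem j p) (f j) (n j))).
  rewrite [X in _ = _ * X](eq_bigr (fun j => headsE (count_mem j p) (f j) (n j))).
    by rewrite -mulrDl mulrAC.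
  by move=> j ji; rewrite eq_sym (negbTE ji).
by move=> j ji; rewrite eq_sym (negbTE ji).
Qed.

End Hits.

Section Cluster.
Variables (R : realType) (M : finMetricType R) (I : finType).
Variables (U : {set M}) (T : I -> {set M}) (B : I -> game M) (b : I -> M) (V : R).
Implicit Types (p h : seq I) (phi : M -> R) (x y : M) (i j : I).

Fixpoint play p : game M :=
  if p is i :: p' then Flip (seqg (B i) (play p')) (play p') else Stop M.

Fixpoint concat h : game M :=
  if h is i :: h' then seqg (B i) (concat h') else Stop M.

Lemma play_cat p p' : play (p ++ p') = seqg (play p) (play p').
Proof. by elim: p => //= i p ->; rewrite seqgA. Qed.

Lemma expect_hitE (g : game M) p (H : seq (M * R) -> seq I -> R) :
  expect g (fun s => hitE p (H s)) = hitE p (fun h => expect g (H^~ h)).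
Proof.
elim: p H => //= i p IH H.
by rewrite expect_half (IH (fun s h => H s (i :: h))) IH.
Qed.

(** The coins that select the hits are independent of those inside the games, so all hits can be
    drawn first. *)
Lemma expect_play p F : expect (play p) F = hitE p (fun h => expect (concat h) F).
Proof.
elim: p F => //= i p IH F; rewrite IH expect_seq; congr ((_ + _) / 2).
transitivity (hitE p (fun h =>
  expect (B i) (fun s => expect (concat h) (fun s' => F (s ++ s'))))).
  by rewrite -expect_hitE; apply: eq_expect => s; rewrite IH.
by congr hitE; apply/funext => h; rewrite expect_seq.
Qed.

Section Online.
Hypothesis V_gt0 : 0 < V.
Hypothesis sepT : forall i j, i != j ->
  {in T i & T j, forall x y, 3 * V <= mdist x y}.
Hypothesis onlineB : forall i phi, {in T i &, forall x y, phi x = phi y} ->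
  lip U phi -> lip U (raise_on (T i) (2 * V) phi) ->
  lower U phi (B i) (raise_on (T i) V phi).

Let S := \bigcup_i T i.

Definition weigh (a : I -> R) phi x := phi x + \sum_i a i * (x \in T i)%:R.

Lemma disjT i j x : x \in T i -> x \in T j -> i = j.
Proof.
move=> xi xj; apply/eqP/negPn/negP => ij.
by have := sepT ij xi xj; have := V_gt0; rewrite mdistxx; lra.
Qed.

Lemma weigh_in a phi i x : x \in T i -> weigh a phi x = phi x + a i.
Proof.
move=> xi; rewrite /weigh (bigD1 i) //= xi mulr1 big1 ?addr0 // => j ji.
case: (boolP (x \in T j)) => [xj|_]; last by rewrite mulr0.
by rewrite (disjT xi xj) eqxx in ji.
Qed.

Lemma weigh_out a phi x : x \notin S -> weigh a phi x = phi x.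
Proof.
move=> xS; rewrite /weigh big1 ?addr0 // => i _.
case: (boolP (x \in T i)) => [xi|_]; last by rewrite mulr0.
by case/negP: xS; apply/bigcupP; exists i.
Qed.

(** Between two clusters [phi] does not vary, and a weight difference up to [3 * V] is absorbed by
    their distance. Between a cluster and the outside, [weigh a phi] lies between [phi] and
    [raise_on S W phi], both Lipschitz. *)
Lemma lip_weigh W a phi : {in S &, forall x y, phi x = phi y} ->
  lip U phi -> lip U (raise_on S W phi) -> (forall i, 0 <= a i <= W) ->
  (forall i j, i != j -> a i <= a j + 3 * V) -> lip U (weigh a phi).
Proof.
move=> cphi Lphi LW aW aa x y Ux Uy; have V0 := V_gt0; have := Lphi x y Ux Uy.
have := LW x y Ux Uy; have := mdist_ge0 x y.
rewrite /raise_on; case: (boolP (x \in S)) => xS; case: (boolP (y \in S)) => yS;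
  rewrite /= ?mulr1 ?mulr0.
- move: xS yS (cphi x y xS yS) => /bigcupP[i _ xi] /bigcupP[j _ yj] exy.
  rewrite (weigh_in _ _ xi) (weigh_in _ _ yj).
  have [<-|ij] := eqVneq i j; first by lra.
  by have := aa i j ij; have := sepT ij xi yj; lra.
- move: xS => /bigcupP[i _ xi]; rewrite (weigh_in _ _ xi) (weigh_out _ _ yS).
  by have /andP[] := aW i; lra.
- move: yS => /bigcupP[i _ yi]; rewrite (weigh_in _ _ yi) (weigh_out _ _ xS).
  by have /andP[] := aW i; lra.
- by rewrite !weigh_out //; lra.
Qed.

(** Suffixes matter because the potential is determined by the game still to come, which is the play
    of a suffix. *)
Definition balanced p := forall k i j,
  (count_mem i (drop k p) <= count_mem j (drop k p) + 1)%N.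

(** A coin for cluster [i] raises the potential on [T i] by [V] half of the time, hence by [V / 2]
    on average. Balance keeps the weights within [V / 2] of each other, so even after adding [2 * V]
    on one cluster, as [onlineB] requires, the gaps stay below [3 * V]. *)
Lemma lower_play p phi W : {in S &, forall x y, phi x = phi y} ->
  lip U phi -> lip U (raise_on S W phi) -> balanced p ->
  (forall i, V / 2 * (count_mem i p)%:R + 2 * V <= W) ->
  lower U phi (play p) (weigh (fun i => V / 2 * (count_mem i p)%:R) phi).
Proof.
move=> cphi Lphi LW; have V0 := V_gt0; elim: p => [|i p IH] balp leW /=.
  by move=> x _; rewrite /weigh big1 ?addr0 // => j _; rewrite mulr0 mul0r.
set a := fun j : I => V / 2 * (count_mem j p)%:R in IH.
have bal0 j k : (count_mem j p <= count_mem k p + 1)%N.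
  by have := balp 1%N j k; rewrite /= drop0.
have {}IH : lower U phi (play p) (weigh a phi).
  apply: IH => [k j j'|j]; first exact: balp k.+1 j j'.
  apply: le_trans (leW j); rewrite lerD2r ler_pM2l ?divr_gt0 // ler_nat /=.
  exact: leq_addl.
have a_ge0 j : 0 <= a j by rewrite mulr_ge0 // ltW // divr_gt0.
have a_leW j : a j + 2 * V <= W.
  apply: le_trans (leW j); rewrite lerD2r ler_pM2l ?divr_gt0 // ler_nat /=.
  exact: leq_addl.
have a_bal j k : a j <= a k + V / 2.
  have : (count_mem j p)%:R <= (count_mem k p)%:R + 1 :> R.
    by rewrite natr1 ler_nat -addn1.
  rewrite -(ler_pM2l (divr_gt0 V_gt0 (ltr0Sn R 1))) => /le_trans; apply.
  by rewrite /a mulrDr mulr1.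
exists (raise_on (T i) V (weigh a phi)), (weigh a phi); split=> //.
  apply: lower_seq IH; apply: onlineB.
  - move=> x y xi yi; rewrite !(@weigh_in _ _ i) //; congr (_ + _).
    by apply: cphi; apply/bigcupP; exists i.
  - apply: lip_weigh LW _ _ => // j; first by have := a_leW j; have := a_ge0 j; lra.
    by move=> k _; have := a_bal j k; lra.
  - have -> : raise_on (T i) (2 * V) (weigh a phi)
        = weigh (fun j => a j + 2 * V * (j == i)%:R) phi.
      apply/funext => x; rewrite /raise_on /weigh -addrA; congr (_ + _).
      rewrite [in RHS](eq_bigr (fun j => a j * (x \in T j)%:R
        + 2 * V * (j == i)%:R * (x \in T j)%:R)); last by move=> j _; rewrite mulrDl.
      rewrite big_split /=; congr (_ + _).
      rewrite (bigD1 i) //= eqxx mulr1 big1 ?addr0 // => j /negbTE ->.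
      by rewrite mulr0 mul0r.
    apply: lip_weigh LW _ _ => // j.
      have := a_leW j; have := a_ge0 j.
      by case: (j == i); rewrite ?mulr1 ?mulr0; lra.
    move=> k _; have := a_bal j k.
    by case: (j == i); case: (k == i); rewrite ?mulr1 ?mulr0; lra.
move=> x Ux; rewrite /raise_on /weigh.
rewrite (eq_bigr (fun j => V / 2 * (i == j)%:R * (x \in T j)%:R
  + a j * (x \in T j)%:R)); last first.
  by move=> j _; rewrite /a natrD mulrDr mulrDl.
rewrite big_split /= (bigD1 i) //= eqxx mulr1 big1 ?addr0; last first.
  by move=> j ji; rewrite eq_sym (negbTE ji) mulr0 mul0r.
by set s := \sum_i _; lra.
Qed.

Definition rounds n := flatten (nseq n (enum I)).

Lemma count_rounds n i : count_mem i (rounds n) = n.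
Proof.
elim: n => //= n IH; rewrite /rounds /= count_cat -/(rounds n) IH.
by rewrite count_uniq_mem ?enum_uniq // mem_enum.
Qed.

Lemma balanced_rounds n : balanced (rounds n).
Proof.
elim: n => [|n IH] k i j; first by rewrite drop_oversize.
rewrite /rounds /= -/(rounds n) drop_cat; case: ifP => _; last exact: IH.
rewrite !count_cat !count_rounds.
suff : (count_mem i (drop k (enum I)) <= 1)%N.
  by move: (count_mem i _) (count_mem j _) => a c; lia.
by rewrite count_uniq_mem ?drop_uniq ?enum_uniq // leq_b1.
Qed.

Lemma lower_rounds n phi W : {in S &, forall x y, phi x = phi y} ->
  lip U phi -> lip U (raise_on S W phi) -> V / 2 * n%:R + 2 * V <= W ->
  lower U phi (play (rounds n)) (raise_on S (V / 2 * n%:R) phi).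
Proof.
move=> cphi Lphi LW leW.
have := lower_play cphi Lphi LW (@balanced_rounds n).
move=> /(_ _)/lower_le; apply; last by move=> i; rewrite count_rounds.
move=> x Ux; rewrite /raise_on; case: (boolP (x \in S)) => xS.
  have /bigcupP[i _ xi] := xS.
  by rewrite (weigh_in _ _ xi) count_rounds mulr1.
by rewrite weigh_out // mulr0 addr0.
Qed.

End Online.

Section Offline.
Variables (i0 : I) (delta1 delta2 D : R).
Hypothesis bU : forall i, b i \in U.
Hypothesis delta2_ge0 : 0 <= delta2.
Hypothesis bD : forall i, mdist (b i0) (b i) <= D.
Hypothesis off_own : forall i,
  off U (B i) (b i) (b i) <= (if i == i0 then delta1 else delta2).
Hypothesis off_other : forall i j, i != j -> off U (B i) (b j) (b j) <= 0.

Lemma off_concat h i : off U (concat h) (b i) (b i)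
  <= (count_mem i h)%:R * (if i == i0 then delta1 else delta2).
Proof.
elim: h => /= [|j h IH]; first by rewrite off_Stop mul0r.
apply: le_trans (off_seq _ _ _ (bU i) (bU i)) _.
rewrite natrD mulrDl lerD //.
have [->|ji] := eqVneq j i; first by rewrite mul1r.
by rewrite mul0r; exact: off_other.
Qed.

(* Offline, watch the number of hits of each cluster: move to a cluster other
   than [i0] hit at most [t] times if there is one, and else stay at [i0]. *)
Lemma off_rounds n (t pi : R) :
  let K := t * delta2 + 2 * D in
  0 <= pi <= headsE n (atmost t) 0 -> K <= n%:R / 2 * delta1 ->
  off U (play (rounds n)) (b i0) (b i0)
  <= K + (1 - pi) ^+ #|I|.-1 * (n%:R / 2 * delta1 - K).
Proof.
move=> K /andP[pi0 pi_le] leK.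
(* The product of the [f i] vanishes as soon as a cluster other than [i0] has at most [t] hits;
   otherwise it is the excess over [K] of the cost of staying at [i0]. In product form, independence
   applies factor by factor. *)
pose f i k : R := if i == i0 then k%:R * delta1 - K else 1 - atmost t k.
apply: (@le_trans _ _ (hitE (rounds n) (fun h => K + \prod_i f i (count_mem i h + 0)%N))).
  rewrite /off expect_play; apply: hitE_le => h.
  under eq_bigr do rewrite addn0.
  rewrite (bigD1 i0) //= {1}/f eqxx.
  case: (pickP (fun i => (i != i0) && ((count_mem i h)%:R <= t))) => [i /andP[ii0 ti]|none].
    rewrite (bigD1 i) //= /f (negbTE ii0) /atmost ti subrr mul0r mulr0 addr0.
    apply: le_trans (off_via _ (bU i0) (bU i)) _.
    rewrite lerD // ?ler_pM2l //.
    apply: le_trans (off_concat h i) _; rewrite (negbTE ii0).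
    by rewrite ler_wpM2r.
  rewrite big1 ?mulr1 => [|i ii0].
    by rewrite addrC subrK; have := off_concat h i0; rewrite eqxx.
  have := none i; rewrite ii0 /= /f (negbTE ii0) /atmost => ->.
  by rewrite subr0.
rewrite hitEDl lerD2l (hitE_prod _ f (fun=> 0%N)).
under eq_bigr do rewrite count_rounds.
rewrite (bigD1 i0) //= {1}/f eqxx.
have -> : headsE n (fun k => k%:R * delta1 - K) 0 = n%:R / 2 * delta1 - K.
  have := @headsED R n (fun k => delta1 * k%:R) (fun=> - K) 0.
  rewrite headsE_cst headsEZ headsE_mean add0r mulrC => <-.
  by congr headsE; apply/funext => k; rewrite mulrC.
rewrite mulrC ler_wpM2r ?subr_ge0 //.
have -> : (1 - pi) ^+ #|I|.-1 = \prod_(i | i != i0) (1 - pi).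
  by rewrite prodr_const cardC1.
apply: ler_prod => i ii0; rewrite /f (negbTE ii0).
have -> : headsE n (fun k => 1 - atmost t k) 0 = 1 - headsE n (atmost t) 0.
  have := @headsED R n (fun=> 1) (fun k => -1 * atmost t k) 0.
  rewrite headsE_cst headsEZ mulN1r => <-.
  by congr headsE; apply/funext => k; rewrite mulN1r.
rewrite subr_ge0 lerD2l lerN2 pi_le andbT.
rewrite -[leRHS](headsE_cst n 1 0); apply: headsE_le => k.
by rewrite /atmost lern1; case: (_ <= _).
Qed.

Lemma off_rounds_repeat n r (C : R) :
  off U (play (rounds n)) (b i0) (b i0) <= C ->
  off U (play (rounds (r * n))) (b i0) (b i0) <= r%:R * C.
Proof.
move=> HC; elim: r => [|r IH]; first by rewrite mul0n mul0r off_Stop.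
have -> : rounds (r.+1 * n) = rounds n ++ rounds (r * n).
  by rewrite /rounds mulSn nseqD flatten_cat.
rewrite play_cat; apply: le_trans (off_seq _ _ _ (bU i0) (bU i0)) _.
by rewrite -natr1 mulrDl mul1r addrC lerD.
Qed.

Lemma off_play_out p x : x \in U -> (forall i, off U (B i) x x <= 0) ->
  off U (play p) x x <= 0.
Proof.
move=> Ux HB; rewrite /off expect_play.
have <- : hitE p (fun=> 0 : R) = 0.
  by elim: p => //= i p ->; lra.
apply: hitE_le => h; rewrite -/(off U _ x x).
elim: h => /= [|i h IH]; first by rewrite off_Stop.
by apply: le_trans (off_seq _ _ _ Ux Ux) _; have := HB i; lra.
Qed.

End Offline.

End Cluster.

(** * The gain at one level *)

Section Gain.
Variable R : realType.

Lemma expRN_le (w : R) : 0 <= w -> expR (- w) <= (1 + w)^-1.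
Proof.
move=> w0; rewrite expRN lef_pV2 ?posrE ?expR_gt0 ?expR_ge1Dx //; lra.
Qed.

Lemma expRN_lin (w g : R) : 1 <= w -> g <= w / 256 ->
  expR (- w) * (2 * (1 + g)) <= 1.
Proof.
move=> w1 gw; have e0 := expR_gt0 w.
suff H : 2 * (1 + g) <= expR w.
  by rewrite expRN -ler_pdivlMl ?invr_gt0 // invrK mulr1.
have -> : expR w = expR (w / 2) ^+ 2.
  by rewrite -expRM_natl; congr expR; rewrite mulrC divfK.
apply: le_trans (_ : (1 + w / 2) ^+ 2 <= _).
  have : 1 * 1 <= w * w by apply: ler_pM.
  rewrite expr2; lra.
by rewrite lerXn2r ?nnegrE ?expR_ge0 ?expR_ge1Dx //; lra.
Qed.

Lemma expRN6_le : expR (- 6) <= 64^-1 :> R.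
Proof.
rewrite expRN lef_pV2 ?posrE ?expR_gt0 //.
rewrite -[6]mulr1 expRM_natl; apply: le_trans (_ : (2 : R) ^+ 6 <= _); first by lra.
rewrite lerXn2r ?nnegrE ?expR_ge0 //.
by have := expR_ge1Dx (1 : R); lra.
Qed.

(** With [y = expR v], one has [1 + y ^+ 4 <= (1 + y) ^+ 4 <= expR (4 * y)]. *)
Lemma ln1D_exp_le (v : R) : ln (1 + expR (4 * v)) <= 4 * expR v.
Proof.
rewrite -ler_expR lnK ?posrE; last by rewrite addr_gt0 ?expR_gt0.
rewrite !expRM_natl; set y := expR v.
have y0 : 0 < y by exact: expR_gt0.
apply: le_trans (_ : (1 + y) ^+ 4 <= _); last first.
  by rewrite lerXn2r ?nnegrE ?expR_ge0 ?expR_ge1Dx //; lra.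
have -> : (1 + y) ^+ 4 = 1 + y ^+ 4 + (4 * y + 6 * y ^+ 2 + 4 * y ^+ 3) by ring.
rewrite lerDl; have := exprn_gt0 2 y0; have := exprn_gt0 3 y0; lra.
Qed.

(** Read [nu / r1] as the cost of staying, [K] as that of moving, and [beta] as the probability of
    having to stay: the expected saving must cover the difference between [nu / r1] and
    [nu / (r1 + g)]. *)
Lemma mix_le (nu r1 g K beta : R) : 0 < r1 -> 0 <= g ->
  nu * g / (r1 * (r1 + g)) <= (1 - beta) * (nu / r1 - K) ->
  K + beta * (nu / r1 - K) <= nu / (r1 + g).
Proof.
move=> r10 g0 H.
have -> : nu / (r1 + g) = nu / r1 - nu * g / (r1 * (r1 + g)).
  by field; rewrite !gt_eqF //; lra.
lra.
Qed.

Section Constant.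
Variable c0 : R.
Hypotheses (c0_gt0 : 0 < c0) (c0_le : c0 <= 64^-1 / 32 / 64).

(* Here [q], [w], [G], [Lam] stand for the number of superblocks, the expected
   number of rarely hit clusters, the logarithm of the growth of the weight, and
   the logarithm of the ratio of weights. *)
Lemma gain_long (A r1 r2 q l w G Lam beta : R) : 1 <= A -> 1 <= r2 -> 0 < q ->
  0 <= w -> 0 <= G ->
  r1 = r2 + c0 / A * Lam -> 0 <= Lam -> Lam <= 24 * q -> G <= 72 * q ->
  1 <= q -> c0 * G <= w / 256 ->
  16 * A * r2 / q <= l -> l <= 32 * A * r2 / q -> 0 < l ->
  0 <= beta <= (1 + w)^-1 ->
  let K := (q * l ^+ 2 / 2 - q * l / 4) / r2 + A in
  K <= q * l ^+ 2 / 2 / r1 /\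
  K + beta * (q * l ^+ 2 / 2 / r1 - K) <= q * l ^+ 2 / 2 / (r1 + c0 / A * G).
Proof.
move=> A1 r21 q0 w0 G0 r1E Lam0 Lamq Gq q1 Gw lge lle l0 /andP[b0 ble] K.
have c00 := c0_gt0; have c0l := c0_le.
have A0 : 0 < A by lra.
have r20 : 0 < r2 by lra.
have D0 : 0 <= c0 / A * Lam by rewrite mulr_ge0 // ltW // divr_gt0.
have r10 : 0 < r1 by lra.
have r12 : r2 <= r1 by lra.
have ql : 16 * A * r2 <= l * q by rewrite -ler_pdivrMr.
have lq : l * q <= 32 * A * r2 by rewrite -ler_pdivlMr.
have lD : 8 * l * (c0 / A * Lam) <= r1.
  have -> : 8 * l * (c0 / A * Lam) = 8 * c0 * l * Lam / A by ring.
  rewrite ler_pdivrMr //.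
  have h1 : l * Lam <= l * (24 * q) by rewrite ler_pM2l.
  have h2 : c0 * (l * Lam) <= (64^-1 / 32 / 64) * (768 * (A * r1)).
    apply: ler_pM => //; [exact: ltW|by rewrite mulr_ge0 // ltW|].
    have : A * r2 <= A * r1 by rewrite ler_pM2l.
    lra.
  have := mulr_gt0 A0 r10; lra.
have gain : q * l / (8 * r2) <= q * l ^+ 2 / 2 / r1 - K.
  have H1 : A <= q * l / (16 * r2) by rewrite ler_pdivlMr ?mulr_gt0 //; lra.
  have H2 : q * l ^+ 2 / 2 / r2 - q * l ^+ 2 / 2 / r1 <= q * l / (16 * r2).
    have -> : q * l ^+ 2 / 2 / r2 - q * l ^+ 2 / 2 / r1
        = q * l / (16 * r2) * ((8 * l * (c0 / A * Lam)) / r1).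
      have -> : c0 / A * Lam = r1 - r2 by lra.
      by field; rewrite !gt_eqF.
    apply: ler_piMr; first by rewrite divr_ge0 ?mulr_ge0 // ltW.
    by rewrite ler_pdivrMr // mul1r.
  have -> : q * l ^+ 2 / 2 / r1 - K = q * l / (4 * r2)
    - (q * l ^+ 2 / 2 / r2 - q * l ^+ 2 / 2 / r1) - A.
    by rewrite /K; field; rewrite !gt_eqF.
  have : q * l / (4 * r2) = 4 * (q * l / (16 * r2)) by field; rewrite !gt_eqF.
  have : q * l / (8 * r2) = 2 * (q * l / (16 * r2)) by field; rewrite !gt_eqF.
  lra.
have gain0 : 0 <= q * l / (8 * r2) by rewrite divr_ge0 ?mulr_ge0 // ltW.
split; first by lra.
have g0 : 0 <= c0 / A * G by rewrite mulr_ge0 // ltW // divr_gt0.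
apply: mix_le => //.
have b1 : w / (1 + w) <= 1 - beta.
  have -> : w / (1 + w) = 1 - (1 + w)^-1 by field; rewrite gt_eqF //; lra.
  lra.
have w1 : 0 < 1 + w by lra.
(* For [w <= 1] the bound of [G] by [w] suffices; beyond, [w / (1 + w)] is at least 1/2 and the
   bound of [G] by [q] takes over. *)
have bq : 128 * c0 * G <= w / (1 + w) * q.
  rewrite [leRHS]mulrAC ler_pdivlMr //.
  have [w1'|w1'] := leP w 1.
    have : w * 1 <= w * q by rewrite ler_wpM2l.
    have : c0 * G * (1 + w) <= w / 256 * 2 by rewrite ler_pM ?mulr_ge0 //; lra.
    lra.
  have : c0 * G <= (64^-1 / 32 / 64) * (72 * q) by rewrite ler_pM //; lra.
  move=> H; have : c0 * G * (1 + w) <= (64^-1 / 32 / 64) * (72 * q) * (2 * w).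
    by rewrite ler_pM ?mulr_ge0 //; lra.
  have : 0 < q * w by rewrite mulr_gt0 //; lra.
  lra.
apply: le_trans (_ : (w / (1 + w)) * (q * l / (8 * r2)) <= _); last first.
  by rewrite ler_pM // ?divr_ge0 //; lra.
apply: le_trans (_ : q * l ^+ 2 / 2 * (c0 / A * G) / (r1 * r2) <= _).
  apply: ler_wpM2l.
    by rewrite mulr_ge0 // divr_ge0 // mulr_ge0 ?exprn_ge0 // ltW.
  rewrite lef_pV2 ?posrE ?mulr_gt0 //; last by lra.
  by rewrite ler_pM2l //; lra.
have -> : q * l ^+ 2 / 2 * (c0 / A * G) / (r1 * r2)
   = (q * l / (8 * r2)) * (4 * c0 * G * l / (A * r1)).
  by field; rewrite !gt_eqF.
rewrite [leRHS]mulrC ler_wpM2l // ler_pdivrMr ?mulr_gt0 //.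
rewrite -(ler_pM2r q0).
have -> : 4 * c0 * G * l * q = 4 * c0 * G * (l * q) by ring.
apply: le_trans (_ : 4 * c0 * G * (32 * A * r1) <= _).
  apply: ler_wpM2l; first by rewrite !mulr_ge0 // ltW.
  have : A * r2 <= A * r1 by rewrite ler_pM2l.
  lra.
have -> : 4 * c0 * G * (32 * A * r1) = 128 * c0 * G * (A * r1) by ring.
have -> : w / (1 + w) * (A * r1) * q = w / (1 + w) * q * (A * r1) by ring.
by rewrite ler_wpM2r // mulr_ge0 // ltW.
Qed.

(** The case of superblocks of a single coin: rarely hit now means never hit, so [K] is the moving
    cost [A] alone. *)
Lemma gain_short (A r1 r2 q w G Lam beta : R) : 1 <= A -> 1 <= r2 ->
  0 <= w -> 0 <= G ->
  r1 = r2 + c0 / A * Lam -> 0 <= Lam -> Lam <= 24 * q -> G <= 72 * q ->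
  1 <= q -> c0 * G <= w / 256 -> 16 * A * r2 <= q ->
  0 <= beta <= expR (- w) ->
  A <= q / 2 / r1 /\
  A + beta * (q / 2 / r1 - A) <= q / 2 / (r1 + c0 / A * G).
Proof.
move=> A1 r21 w0 G0 r1E Lam0 Lamq Gq q1 Gw qge /andP[b0 ble].
have c00 := c0_gt0; have c0l := c0_le.
have A0 : 0 < A by lra.
have r20 : 0 < r2 by lra.
have D0 : 0 <= c0 / A * Lam by rewrite mulr_ge0 // ltW // divr_gt0.
have r10 : 0 < r1 by lra.
have Ar1 : A * r1 = A * r2 + c0 * Lam by rewrite r1E; field; rewrite gt_eqF.
have cL : c0 * Lam <= (64^-1 / 32 / 64) * (24 * q) by rewrite ler_pM //; lra.
have cG : c0 * G <= (64^-1 / 32 / 64) * (72 * q) by rewrite ler_pM //; lra.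
have Aq : 8 * (A * r1) <= q by lra.
have [g gE] : exists g, g = c0 / A * G by exists (c0 / A * G).
rewrite -gE; have g0 : 0 <= g by rewrite gE mulr_ge0 // ltW // divr_gt0.
have Ag : A * g = c0 * G by rewrite gE; field; rewrite gt_eqF.
have gw : g <= w / 256.
  apply: le_trans Gw; rewrite -Ag ler_peMl //.
have gain : 3 / 8 * (q / r1) <= q / 2 / r1 - A.
  have : A <= q / 8 / r1 by rewrite ler_pdivlMr //; lra.
  have : q / 8 / r1 = (q / r1) / 8 by rewrite mulrAC.
  have : q / 2 / r1 = (q / r1) / 2 by rewrite mulrAC.
  lra.
have qr0 : 0 <= q / r1 by rewrite divr_ge0 ?ltW //; lra.
split; first by lra.
have r11 : 1 <= r1 by lra.
have r1g1 : 1 <= r1 + g by rewrite -[leLHS]addr0 lerD.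
have r1g0 : 0 < r1 + g by exact: lt_le_trans r1g1.
(* For [w <= 1] the failure probability is at most [1 - w / 2], a linear gain. For [w >= 1] it is so
   small that [A] and the remaining term are each at most half of the target. *)
have [w1|/ltW w1] := leP w 1.
  apply: mix_le => //.
  have b1 : w / 2 <= 1 - beta.
    have := expRN_le w0; have : (1 + w)^-1 <= 1 - w / 2.
      rewrite -[leLHS]mul1r ler_pdivrMr; last by lra.
      have : w * w <= w * 1 by rewrite ler_wpM2l.
      lra.
    lra.
  apply: le_trans (_ : w / 2 * (3 / 8 * (q / r1)) <= _); last first.
    by apply: ler_pM => //; [rewrite divr_ge0|rewrite mulr_ge0].
  have -> : q / 2 * g / (r1 * (r1 + g)) = (q / r1) * (g / 2 / (r1 + g)).
    by field; rewrite !gt_eqF.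
  have -> : w / 2 * (3 / 8 * (q / r1)) = (q / r1) * (3 / 16 * w).
    by field; rewrite gt_eqF.
  rewrite ler_wpM2l // ler_pdivrMr //.
  have : w * 1 <= w * (r1 + g) by apply: ler_wpM2l.
  move: w0 gw; clear=> w0 gw H.
  lra.
have H1 : A <= q / 4 / (r1 + g).
  rewrite ler_pdivlMr // mulrDr Ag; lra.
have H2 : beta * (q / 2 / r1 - A) <= q / 4 / (r1 + g).
  apply: le_trans (_ : expR (- w) * (q / 2 / r1) <= _).
    by rewrite ler_pM //; lra.
  have ew : expR (- w) * (2 * (1 + g)) <= 1. by exact: expRN_lin.
  rewrite ler_pdivlMr //.
  have -> : expR (- w) * (q / 2 / r1) * (r1 + g)
    = (q / 4) * (expR (- w) * (2 * (1 + g / r1))) by field; rewrite gt_eqF.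
  rewrite ler_piMr //; first by lra.
  apply: le_trans ew; rewrite ler_wpM2l ?expR_ge0 // ler_pM2l // lerD2l.
  by rewrite ler_pdivrMr // ler_peMr //; lra.
have -> : q / 2 / (r1 + g) = q / 4 / (r1 + g) + q / 4 / (r1 + g).
  by field; rewrite gt_eqF.
exact: lerD.
Qed.

End Constant.

End Gain.

Section NodeGain.
Variable R : realType.

(** The value for which [gain_cst * (4 * expR v)] equals [w / 256] in [node_gain]; there
    [expR (- 6)] bounds from below the probability that a superblock has few heads. *)
Definition gain_cst : R := expR (- 6) / 32 / 64.

Lemma gain_cst_gt0 : 0 < gain_cst.
Proof. by rewrite !divr_gt0 ?expR_gt0. Qed.

Lemma gain_cst_le : gain_cst <= 64^-1 / 32 / 64.
Proof. by rewrite !ler_pM2r ?invr_gt0 // expRN6_le. Qed.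

Lemma ln_nat_ge0 k : 0 <= ln k%:R :> R.
Proof. by case: k => [|k]; [rewrite ln0|rewrite ln_ge0 // ler1n]. Qed.

Lemma ler_ln_nat j k : (0 < j)%N -> (j <= k)%N -> ln j%:R <= ln k%:R :> R.
Proof.
by move=> j0 jk; rewrite ler_ln ?posrE ?ltr0n ?ler_nat // (leq_trans j0).
Qed.

Definition rate (A : R) (k : nat) : R := 1 + gain_cst / A * ln k%:R.

Lemma rate_ge1 A k : 0 < A -> 1 <= rate A k.
Proof.
by move=> A0; rewrite lerDl mulr_ge0 ?ln_nat_ge0 // divr_ge0 ?ltW ?gain_cst_gt0.
Qed.

Lemma rate_le A j k : 0 < A -> (0 < j)%N -> (j <= k)%N -> rate A j <= rate A k.
Proof.
move=> A0 j0 jk; rewrite lerD2l ler_wpM2l ?ler_ln_nat //.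
by rewrite divr_ge0 ?ltW ?gain_cst_gt0.
Qed.

Lemma pow_one_minus_le (p w : R) m : 0 <= p <= 1 -> w <= m%:R * p ->
  0 <= (1 - p) ^+ m <= expR (- w).
Proof.
move=> /andP[p0 p1] wp; rewrite exprn_ge0 ?subr_ge0 //=.
apply: le_trans (_ : expR (- p) ^+ m <= _).
  by rewrite lerXn2r ?nnegrE ?expR_ge0 ?subr_ge0 // expR_ge1Dx.
by rewrite -expRM_natl ler_expR mulrN lerN2.
Qed.

(** The [N] coins of a cluster form [q] superblocks. Each has [l * l] coins, with [l] just large
    enough for the deviation to pay for the move [A], or a single coin if [q] alone is large enough.
    [N / 2] is the mean number of hits, and [t] the number at which a cluster counts as rarely
    hit. *)
Lemma node_gain (A : R) (k1 k2 m n : nat) : 1 <= A -> (0 < k2)%N ->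
  (k2 <= k1)%N -> (k1 <= n)%N -> (0 < m < n)%N ->
  exists (N : nat) (t p : R), [/\ (0 < N)%N,
    N%:R <= (32 * A * (1 + ln n%:R)) ^+ 2,
    0 <= p <= headsE N (atmost t) 0,
    t / rate A k2 + A <= N%:R / 2 / rate A k1 &
    t / rate A k2 + A
      + (1 - p) ^+ m * (N%:R / 2 / rate A k1 - (t / rate A k2 + A))
    <= N%:R / 2 / (rate A k1
         + gain_cst / A * ln (1 + m.+1%:R ^+ 2 * (k2%:R / k1%:R)))].
Proof.
move=> A1 k20 k21 k1n /andP[m0 mn].
have A0 : 0 < A by exact: lt_le_trans A1.
have k10 : (0 < k1)%N by exact: leq_trans k21.
have n0 : (0 < n)%N by exact: leq_trans k1n.
pose eta : R := ln m.+1%:R; pose Lam : R := ln k1%:R - ln k2%:R.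
have Lam0 : 0 <= Lam by rewrite subr_ge0 ler_ln_nat.
have eta0 : 0 <= eta by exact: ln_nat_ge0.
pose X := eta + Lam.
have X0 : 0 <= X by exact: addr_ge0.
pose q := (Num.truncn (X / 24)).+1.
have /andP[q_le q_gt] := truncn_itv (divr_ge0 X0 (ler0n R 24)).
have qX : X <= 24 * q%:R.
  by have := ltW q_gt; rewrite -/q ler_pdivrMr // mulrC.
have {q_le} qle : q%:R <= X / 24 + 1 by rewrite /q -natr1 lerD2r.
have q1 : 1 <= q%:R :> R by rewrite ler1n.
(* Since [q <= X / 24 + 1], the [m] clusters have at least [m * expR (- 6) ^+ q >= w] rarely hit
   ones on average; the factor 1/2 in [w] passes from [m.+1] to [m]. Moreover
   [4 * v = 3 * eta - Lam], so [expR (4 * v)] dominates [m.+1 ^ 2 * (k2 / k1)]. *)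
pose v := eta - X / 4.
pose w := expR (- 6) / 2 * expR v.
have w0 : 0 <= w by rewrite mulr_ge0 ?divr_ge0 ?expR_ge0.
pose G := ln (1 + m.+1%:R ^+ 2 * (k2%:R / k1%:R)) : R.
have M1 : 2 <= m.+1%:R :> R by rewrite (ler_nat R 2).
have Me : m.+1%:R = expR eta by rewrite /eta lnK // posrE ltr0n.
have ue : k2%:R / k1%:R = expR (- Lam) :> R.
  by rewrite /Lam opprB expRB !lnK // posrE ltr0n.
have u1 : k2%:R / k1%:R <= 1 :> R.
  by rewrite ler_pdivrMr ?ltr0n // mul1r ler_nat.
have u0 : 0 <= k2%:R / k1%:R :> R by rewrite divr_ge0.
have G0 : 0 <= G by rewrite ln_ge0 // lerDl mulr_ge0 ?exprn_ge0.
have Gw : gain_cst * G <= w / 256.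
  apply: le_trans (_ : gain_cst * (4 * expR v) <= _); last first.
    rewrite /w /gain_cst; have := expR_ge0 v; set E := expR v.
    set F := expR (- 6); lra.
  rewrite ler_wpM2l //; first exact: ltW gain_cst_gt0.
  apply: le_trans (ln1D_exp_le v).
  rewrite ler_ln ?posrE ?ltr_wpDr ?expR_ge0 ?mulr_ge0 ?exprn_ge0 // lerD2l.
  rewrite Me ue -expRM_natl -expRD ler_expR /v /X; lra.
have GX : G <= 3 * X.
  apply: le_trans (_ : 3 * eta <= _); last by rewrite /X; lra.
  rewrite -ler_expR lnK; last first.
    by rewrite posrE ltr_wpDr ?mulr_ge0 ?exprn_ge0.
  rewrite expRM_natl -Me; set a : R := m.+1%:R in M1 *.
  have a2 : 0 <= a ^+ 2 by exact: sqr_ge0.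
  have : a ^+ 2 * (k2%:R / k1%:R) <= a ^+ 2 by rewrite ler_piMr.
  have : 2 * a ^+ 2 <= a ^+ 3 by rewrite [leRHS]exprS ler_wpM2r.
  have : 2 * 2 <= a ^+ 2 by rewrite expr2 ler_pM.
  lra.
have Gq : G <= 72 * q%:R by move: GX qX; clear; lra.
have Lamq : Lam <= 24 * q%:R by apply: le_trans qX; rewrite lerDr.
have wp : w <= m%:R * expR (- 6) ^+ q.
  apply: le_trans (_ : m.+1%:R / 2 * expR (- 6) ^+ q <= _); last first.
    by rewrite ler_wpM2r ?exprn_ge0 ?expR_ge0 // -natr1; have : 1 <= m%:R :> R;
      [rewrite ler1n|lra].
  rewrite Me -expRM_natl /w [X in X <= _]mulrAC -expRD [leRHS]mulrAC -expRD.
  rewrite ler_pM2r ?invr_gt0 // ler_expR /v; move: qle; clear; lra.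
have r1E : rate A k1 = rate A k2 + gain_cst / A * Lam.
  by rewrite /rate /Lam; ring.
have r21 := rate_ge1 k2 A0.
have Ln : 1 + X / 24 <= 1 + ln n%:R.
  have : eta <= ln n%:R by exact: ler_ln_nat.
  have : ln k1%:R <= ln n%:R :> R by exact: ler_ln_nat.
  have := ln_nat_ge0 k2; have := ln_nat_ge0 n; rewrite /X /Lam; clear; lra.
have n_ge0 := ln_nat_ge0 n.
pose x := 16 * A * rate A k2 / q%:R.
have p01 : 0 <= expR (- 6 : R) ^+ q <= 1.
  have e1 : expR (- 6) <= 1 :> R.
    by apply: le_trans (@expRN6_le R) _; clear; lra.
  by apply/andP; split; [rewrite exprn_ge0 ?expR_ge0|rewrite exprn_ile1 ?expR_ge0].
have [x1|x1] := leP 1 x.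
  pose l := (Num.truncn x).+1.
  have /andP[l_le l_gt] := truncn_itv (le_trans ler01 x1).
  have l0 : 0 < l%:R :> R by rewrite ltr0n.
  have lge : x <= l%:R by exact: ltW.
  have lle : l%:R <= 32 * A * rate A k2 / q%:R.
    have -> : 32 * A * rate A k2 / q%:R = x + x by rewrite /x; ring.
    by rewrite /l -natr1 lerD.
  exists (q * (l * l))%N, (q%:R * ((l * l)%N%:R / 2 - l%:R / 4)), (expR (- 6) ^+ q).
  have NE : (q * (l * l))%N%:R = q%:R * l%:R ^+ 2 :> R by rewrite !natrM expr2.
  have tE : q%:R * ((l * l)%N%:R / 2 - l%:R / 4)
      = q%:R * l%:R ^+ 2 / 2 - q%:R * l%:R / 4 :> R by rewrite natrM; field.
  have [] := @gain_long R gain_cst gain_cst_gt0 gain_cst_le A (rate A k1) (rate A k2) q%:R l%:R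
    w G Lam ((1 - expR (- 6) ^+ q) ^+ m) => //.
    - have /andP[-> /le_trans] := pow_one_minus_le p01 wp; apply.
      exact: expRN_le.
  rewrite NE tE => H1 H2; split=> //.
  - apply: le_trans (_ : (q%:R * l%:R) ^+ 2 <= _).
      rewrite exprMn; apply: ler_wpM2r; first exact: exprn_ge0 (ltW l0).
      by rewrite expr2 ler_peMl.
    apply: lerXn2r; rewrite ?nnegrE.
    - by rewrite mulr_ge0.
    - by rewrite !mulr_ge0 ?addr_ge0 // ltW.
    move: lle; rewrite ler_pdivlMr ?(lt_le_trans _ q1) // mulrC => /le_trans; apply.
    apply: ler_wpM2l; first by rewrite mulr_ge0 // ltW.
    rewrite /rate lerD2l.
    apply: le_trans (_ : 1 * ln n%:R <= _); last by rewrite mul1r.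
    apply: ler_pM; rewrite ?ln_nat_ge0 //.
    - by rewrite divr_ge0 // ltW ?gain_cst_gt0.
    - rewrite ler_pdivrMr // mul1r; apply: le_trans A1.
      by apply: le_trans gain_cst_le _; clear; lra.
    - exact: ler_ln_nat (leq_trans k21 k1n).
  - case/andP: p01 => -> _; rewrite -tE.
    have i64 : 0 <= 64^-1 :> R by rewrite invr_ge0.
    have lN : (0 < l)%N by [].
    apply: le_trans (headsE_atmost_mul q i64 (headsE_deviation R lN)).
    by rewrite lerXn2r ?nnegrE ?expR_ge0 ?expRN6_le.
have x2 : 16 * A * rate A k2 <= q%:R.
  by move: (ltW x1); rewrite /x ler_pdivrMr ?mul1r // (lt_le_trans _ q1).
exists q, 0, (expR (- 6) ^+ q); rewrite mul0r add0r.
have [] := @gain_short R gain_cst gain_cst_gt0 gain_cst_le A (rate A k1) (rate A k2) q%:R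
    w G Lam ((1 - expR (- 6) ^+ q) ^+ m) => //.
  exact: pow_one_minus_le.
move=> H1 H2; split=> //.
- have L1 : 1 <= 1 + ln n%:R :> R by rewrite lerDl.
  have A32 : 1 <= 32 * A by move: A1; clear; lra.
  have Y1 : 1 + ln n%:R <= 32 * A * (1 + ln n%:R).
    by apply: ler_peMl => //; exact: le_trans ler01 L1.
  have qY : q%:R <= 32 * A * (1 + ln n%:R).
    by apply: le_trans qle _; rewrite addrC; exact: le_trans Ln Y1.
  apply: le_trans qY _; rewrite expr2; apply: ler_peMl.
    exact: le_trans ler01 (le_trans L1 Y1).
  exact: le_trans L1 Y1.
- case/andP: p01 => -> _; apply: le_trans (headsE_all_miss R q).
  rewrite lerXn2r ?nnegrE ?expR_ge0 ?invr_ge0 //.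
  by apply: le_trans (@expRN6_le R) _; clear; lra.
Qed.

End NodeGain.

(** * Sets with a guaranteed ratio at all large scales *)

Section Hard.
Variables (R : realType) (M : finMetricType R).
Implicit Types (U S : {set M}) (phi : M -> R) (x y b : M) (rho r V A Z : R).

(* [hard S rho r]: for every scale [V >= rho] there is a game on [S] costing an
   online player of [S] at least [V], and an offline player at most [V / r]. A
   player outside [S] pays nothing; the hypothesis on [phi] (the cost of the
   rest of the game) says that entering or leaving [S] is too expensive. *)
Definition hard S rho r := forall U V, S \subset U -> rho <= V -> 0 < V ->
  exists gb : game M * M, [/\ gb.2 \in S,
    forall phi, {in S &, forall x y, phi x = phi y} -> lip U phi ->
      lip U (raise_on S (2 * V) phi) -> lower U phi gb.1 (raise_on S V phi),
    off U gb.1 gb.2 gb.2 <= V / r &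
    forall y, y \in U -> y \notin S -> off U gb.1 y y <= 0].

Lemma hard_le S rho rho' r r' : rho <= rho' -> 0 < r' -> r' <= r ->
  hard S rho r -> hard S rho' r'.
Proof.
move=> rho_le r'0 r_le H U V SU Vge V0.
have [gb [bS Hon Hoff Hout]] := H U V SU (le_trans rho_le Vge) V0.
exists gb; split=> //; apply: le_trans Hoff _.
by rewrite ler_pM2l // lef_pV2 ?posrE // (lt_le_trans r'0).
Qed.

Lemma hard_set1 x rho : hard [set x] rho 1.
Proof.
move=> U V; rewrite finset.sub1set => xU _ V0.
exists (Play x V (Stop M), x); split=> /=.
- by rewrite inE.
- move=> phi _ L1 L2; apply: lower_Play1; first exact: ltW.
  move=> y z yU zU; have := L1 y z yU zU; have := L2 y z yU zU.
  by rewrite /raise_on !inE; case: (y == x); case: (z == x);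
    rewrite /= ?mulr1 ?mulr0; move: V0; clear; lra.
- by apply: le_trans (off_Play1 _ _ xU) _; rewrite eqxx mul1r divr1 gtr0_norm.
- move=> y yU; rewrite inE => /negbTE yx.
  by apply: le_trans (off_Play1 _ _ yU) _; rewrite yx mul0r.
Qed.

(** The clusters are played in [q] batches of [N] rounds with games of value [V]. Repetition lets
    [V] stay comparable to [Z / A] however large [VS] is, and each batch pays for its own moves. *)
Lemma hard_node m (T : 'I_m.+1 -> {set M}) A Z rho (k1 k2 n : nat) :
  2 <= A -> 0 < Z -> rho <= 2 * Z / A ->
  (forall i j, i != j -> {in T i & T j, forall x y, 12 * Z / A <= mdist x y}) ->
  (forall i j, {in T i & T j, forall x y, mdist x y <= Z}) ->
  (0 < k2)%N -> (k2 <= k1)%N -> (k1 <= n)%N -> (0 < m < n)%N ->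
  (forall i, hard (T i) rho (if i == ord0 then rate A k1 else rate A k2)) ->
  hard (\bigcup_i T i) ((32 * A * (1 + ln n%:R)) ^+ 2 * Z)
    (rate A k1 + gain_cst R / A * ln (1 + m.+1%:R ^+ 2 * (k2%:R / k1%:R))).
Proof.
move=> A2 Z0 rho_le sepT diamT k20 k21 k1n mn hardT U VS SU VSge VS0.
have A0 : 0 < A by exact: lt_le_trans A2.
have A1 : 1 <= A by move: A2; clear; lra.
have [N [t [p [N0 Nle p01 K_le K_gain]]]] := node_gain A1 k20 k21 k1n mn.
set kap := (32 * A * _) ^+ 2 in VSge Nle.
have N0' : 0 < N%:R :> R by rewrite ltr0n.
have kap4 : 4 <= kap.
  have L1 : 1 <= 1 + ln n%:R :> R by rewrite lerDl ln_nat_ge0.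
  have : 2 <= 32 * A * (1 + ln n%:R).
    apply: le_trans (_ : 32 * A <= _); first by move: A2; clear; lra.
    by apply: ler_peMr => //; move: A2; clear; lra.
  by rewrite /kap; set Y := 32 * A * _ => Y2; have := ler_pM _ _ Y2 Y2;
    rewrite -expr2 => /(_ (ler0n _ 2) (ler0n _ 2)); clear; lra.
(* Rounding [z] up to [q] puts [A * V] between [2 * Z] and [4 * Z]: moves across the diameter [Z]
   cost at most [A * V / 2], and the separation [12 * Z / A] is at least [3 * V]. *)
pose z := VS * A / (2 * N%:R * Z).
have z1 : 1 <= z.
  rewrite /z ler_pdivlMr ?mulr_gt0 // mul1r.
  have -> : 2 * N%:R * Z = (N%:R * Z) * 2 by ring.
  apply: ler_pM => //; first by rewrite mulr_ge0 // ltW.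
  by apply: le_trans VSge; rewrite ler_pM2r.
pose q := (Num.truncn z).+1.
have /andP[q_le q_gt] := truncn_itv (le_trans ler01 z1).
have {q_le} qle : q%:R <= 2 * z.
  rewrite /q -natr1; move: q_le z1; clear; lra.
have {q_gt} qge : z <= q%:R by exact: ltW.
have q0 : 0 < q%:R :> R by rewrite ltr0n.
pose V := 2 * VS / (N%:R * q%:R).
have V0 : 0 < V by rewrite divr_gt0 ?mulr_gt0.
have VE : V * A / (2 * Z) = 2 * z / q%:R.
  by rewrite /V /z; field; rewrite !gt_eqF.
have Vlow : 2 * Z <= A * V.
  rewrite -[leLHS]mul1r -ler_pdivlMr ?mulr_gt0 // [A * V]mulrC VE.
  by rewrite ler_pdivlMr // mul1r.
have Vup : A * V <= 4 * Z.
  have -> : 4 * Z = 2 * (2 * Z) by ring.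
  rewrite -ler_pdivrMr ?mulr_gt0 // [A * V]mulrC VE.
  by rewrite ler_pdivrMr // ler_pM2l.
have TU i : T i \subset U.
  by apply: fintype.subset_trans SU; exact: (finset.bigcup_sup i).
have rhoV : rho <= V.
  by apply: le_trans rho_le _; rewrite ler_pdivrMr // [V * A]mulrC.
have [gb Hgb] := fin_all_exists (fun i => hardT i U V (TU i) rhoV V0).
pose B i := (gb i).1; pose b i := (gb i).2.
have bT i : b i \in T i by have [] := Hgb i.
have bU i : b i \in U by exact: (fintype.subsetP (TU i) _ (bT i)).
have sep3 i j : i != j -> {in T i & T j, forall x y, 3 * V <= mdist x y}.
  move=> ij x y xi yj; apply: le_trans (sepT i j ij x y xi yj).
  by rewrite ler_pdivlMr //; move: Vup; clear; lra.
have outT i j x : i != j -> x \in T j -> x \notin T i.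
  move=> ij xj; apply/negP => xi.
  by have := sep3 i j ij x x xi xj; rewrite mdistxx; move: V0; clear; lra.
have NV : V / 2 * (q * N)%N%:R = VS.
  by rewrite natrM /V; field; rewrite !gt_eqF.
have r2_0 : 0 < rate A k2 by exact: lt_le_trans (rate_ge1 k2 A0).
have r1_0 : 0 < rate A k1 by exact: lt_le_trans (rate_ge1 k1 A0).
exists (play B (rounds _ (q * N)), b ord0); split=> /=.
- by apply/bigcupP; exists ord0.
- move=> phi cphi L1 L2; rewrite -NV.
  apply: (lower_rounds V0 sep3 _ cphi L1 L2).
    by move=> i psi Hc Hl Hr; have [_ + _ _] := Hgb i; apply.
  rewrite NV; have : V <= 2 * Z.
    have : 2 * V <= A * V by rewrite ler_pM2r.
    by move: Vup; clear; lra.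
  have : 4 * Z <= kap * Z by rewrite ler_pM2r.
  by move: VSge; clear; lra.
- have HD i : mdist (b ord0) (b i) <= A * V / 2.
    apply: le_trans (diamT _ _ _ _ (bT ord0) (bT i)) _.
    by rewrite ler_pdivlMr // mulrC.
  have own i : off U (B i) (b i) (b i)
      <= (if i == ord0 then V / rate A k1 else V / rate A k2).
    by have [_ _ + _] := Hgb i; case: (i == ord0).
  have other i j : i != j -> off U (B i) (b j) (b j) <= 0.
    by move=> ij; have [_ _ _] := Hgb i; apply; [exact: bU|exact: outT ij (bT j)].
  have d2 : 0 <= V / rate A k2 by rewrite divr_ge0 ?ltW.
  have KE : t * (V / rate A k2) + 2 * (A * V / 2) = V * (t / rate A k2 + A).
    by field; rewrite gt_eqF.
  have dE : N%:R / 2 * (V / rate A k1) = V * (N%:R / 2 / rate A k1).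
    by field; rewrite gt_eqF.
  have Kle : t * (V / rate A k2) + 2 * (A * V / 2) <= N%:R / 2 * (V / rate A k1).
    by rewrite KE dE ler_pM2l.
  have := off_rounds bU d2 HD own other p01 Kle.
  rewrite KE dE card_ord /= -mulrBr mulrCA -mulrDr => H1.
  have H2 := le_trans H1 (ler_wpM2l (ltW V0) K_gain).
  have := off_rounds_repeat bU q H2.
  move=> /le_trans; apply; rewrite -NV natrM; set r' := (_ + _)^-1.
  by rewrite le_eqVlt; apply/orP; left; apply/eqP; ring.
- move=> y yU yS; apply: off_play_out => // i.
  have [_ _ _] := Hgb i; apply=> //; apply: contra yS => yi.
  by apply/bigcupP; exists i.
Qed.

End Hard.

(** * Randomized algorithms against random task sequences *)

Section Link.
Variables (R : realType) (M : finMetricType R).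
Implicit Types (U S : {set M}) (x y z b v : M) (a : M * R) (g : game M).

(** The infinite costs confine both players to [U]. *)
Definition task_of U a : task M := fun y =>
  if y \in U then
    if y == a.1 then (`|a.2|%:E)%:nng%E else (0%:E)%:nng%E
  else (+oo)%:nng%E.

Lemma task_ofE U a y :
  (task_of U a y)%:num%E = if y \in U then (pcost a y)%:E else +oo%E.
Proof. by rewrite /task_of /pcost; case: ifP => // _; case: ifP. Qed.

(** An extended-real version of [expect], as an algorithm leaving [U] pays [+oo]. *)
Fixpoint eexpect g (F : seq (M * R) -> \bar R) : \bar R :=
  match g with
  | Stop => F [::]
  | Play z v h => eexpect h (fun s => F ((z, v) :: s))
  | Flip h k => ((eexpect h F + eexpect k F) * (2^-1)%:E)%E
  end.

Lemma half_ge0 : (0 <= (2^-1)%:E :> \bar R)%E.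
Proof. by rewrite lee_fin invr_ge0. Qed.

Lemma eexpect_ge0 g F : (forall s, 0 <= F s)%E -> (0 <= eexpect g F)%E.
Proof.
elim: g F => [|z v h IH|h IH k IHk] F F0 //=; first by apply: IH => s.
by rewrite mule_ge0 ?half_ge0 // adde_ge0 ?IH ?IHk.
Qed.

Lemma eexpect_le g F F' : (forall s, F s <= F' s)%E ->
  (eexpect g F <= eexpect g F')%E.
Proof.
elim: g F F' => [|z v h IH|h IH k IHk] F F' FF' //=; first by apply: IH => s.
by rewrite lee_wpmul2r ?half_ge0 // leeD ?IH ?IHk.
Qed.

Lemma eexpect_EFin g F : eexpect g (fun s => (F s)%:E) = (expect g F)%:E.
Proof.
by elim: g F => [|z v h IH|h IH k IHk] F //=; rewrite IH IHk -EFinD -EFinM.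
Qed.

Lemma eexpectDl g K F : (0 <= K)%E -> (forall s, 0 <= F s)%E ->
  eexpect g (fun s => K + F s)%E = (K + eexpect g F)%E.
Proof.
move=> K0; elim: g F => [|z v h IH|h IH k IHk] F F0 //=.
  exact: (IH (fun s => F ((z, v) :: s))).
rewrite IH // IHk // addeACA ge0_muleDl ?adde_ge0 ?eexpect_ge0 //.
congr (_ + _)%E; clear IH IHk; case: K K0 => [r r0| _|//].
  by rewrite -EFinD -EFinM; congr EFin; field.
by rewrite addye // mulyr gtr0_sg ?mul1e // invr_gt0.
Qed.

Fixpoint run_cost (pos : seq (task M) -> M) (h s : seq (task M)) : \bar R :=
  if s is c :: s' then
    let y := pos (rcons h c) in
    ((mdist (pos h) y)%:E + (c y)%:num + run_cost pos (rcons h c) s')%E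
  else 0%E.

Lemma run_cost_ge0 pos h s : (0 <= run_cost pos h s)%E.
Proof.
elim: s h => //= c s IH h.
by rewrite adde_ge0 // adde_ge0 ?lee_fin ?mdist_ge0.
Qed.

Lemma serve_cost_run (pos : seq (task M) -> M) h s :
  serve_cost (pos h) s [seq pos (h ++ take i.+1 s) | i <- iota 0 (size s)]
  = run_cost pos h s.
Proof.
elim: s h => //= c s IH h; rewrite take0 cats1 -IH (iotaDl 1 0) -map_comp.
by congr (_ + serve_cost _ _ _)%E; apply: eq_map => i /=; rewrite cat_rcons.
Qed.

(** For fixed random bits the algorithm is a deterministic player who sees only the tasks, hence
    knows no more than the player of [lower]; leaving [U] makes its expected cost infinite. *)
Lemma lower_run_cost U g psi (pos : seq (task M) -> M) h :
  lower U (fun=> 0) g psi -> pos h \in U ->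
  ((psi (pos h))%:E
    <= eexpect g (fun s => run_cost pos h (map (task_of U) s)))%E.
Proof.
elim: g psi h => [|z v g IH|g IH k IHk] psi h /=.
- by move=> Hpsi Uh; rewrite lee_fin Hpsi.
- move=> [chi Hchi Hpsi] Uh; set c := task_of U (z, v); set y := pos (rcons h c).
  rewrite (eexpectDl g) => [||s]; last exact: run_cost_ge0; last first.
    by rewrite adde_ge0 ?lee_fin ?mdist_ge0.
  have E0 : (0 <= eexpect g (fun s => run_cost pos (rcons h c) (map (task_of U) s)))%E.
    by apply: eexpect_ge0 => s; exact: run_cost_ge0.
  rewrite task_ofE; case: ifP => Uy; last first.
    by rewrite addey // addye ?leey // gt_eqF // (lt_le_trans _ E0).
  apply: le_trans (leeD (lexx _) (IH chi (rcons h c) Hchi Uy)).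
  by rewrite -!EFinD lee_fin; exact: Hpsi.
- move=> [c1 [c2 [H1 H2 Hpsi]]] Uh.
  apply: le_trans (_ : ((c1 (pos h))%:E + (c2 (pos h))%:E) * (2^-1)%:E <= _)%E.
    by rewrite -EFinD -EFinM lee_fin Hpsi.
  by rewrite lee_wpmul2r ?half_ge0 // leeD ?IH ?IHk.
Qed.

Lemma serve_cost_ge0 x (s : seq (task M)) p : (0 <= serve_cost x s p)%E.
Proof.
elim: s x p => [|c s IH] x [|y p] //=.
by rewrite adde_ge0 // adde_ge0 ?lee_fin ?mdist_ge0.
Qed.

Lemma cost_opt_ge0 x (s : seq (task M)) : (0 <= cost_opt x s)%E.
Proof.
by apply: le_bigmin; rewrite ?le0y // => p _; exact: serve_cost_ge0.
Qed.

Lemma opt_path U x s y : x \in U -> exists2 p : seq M, size p = size s &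
  (serve_cost x (map (task_of U) s) p <= (opt U x s y)%:E)%E.
Proof.
elim: s x => [|a s IH] x Ux /=.
  by exists [::] => //; rewrite lee_fin mdist_ge0.
have [z Uz ->] := minoverP (fun z => mdist x z + pcost a z + opt U z s y) Ux.
have [p ps Hp] := IH z Uz; exists (z :: p); first by rewrite /= ps.
by rewrite /= task_ofE Uz !EFinD leeD.
Qed.

Lemma cost_opt_le U x b a s : b \in U -> pcost a b = 0 ->
  (cost_opt x (map (task_of U) (a :: s)) <= (mdist x b + opt U b s b)%:E)%E.
Proof.
move=> Ub ab; have [p ps Hp] := opt_path s b Ub.
have psz : size (b :: p) == size (map (task_of U) (a :: s)).
  by rewrite /= ps size_map.
apply: le_trans (bigmin_le _ (Tuple psz) _) _.
by rewrite /= task_ofE Ub ab adde0 EFinD leeD.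
Qed.

Section Measurability.
Variables (v0 : M) (d : measure_display) (Omega : measurableType d).
Variable A : randomized_online_algorithm v0 Omega.

Lemma measurable_finite_range (T : finType) (X : Omega -> T) (G : T -> \bar R) :
  (forall t, measurable [set w | X w = t]%classic) ->
  measurable_fun setT (fun w => G (X w)).
Proof.
move=> mX _ B mB; rewrite setTI.
rewrite (_ : _ @^-1` _ = \bigcup_(t in [set t | B (G t)]) [set w | X w = t])%classic.
  by apply: fin_bigcup_measurable => //; exact: finite_finset.
apply/seteqP; split=> [w Bw|w [t Bt /= Xt]]; first by exists (X w).
by rewrite /= Xt.
Qed.

Lemma measurable_run_cost h s :
  measurable_fun setT (fun w => run_cost (position A w) h s).
Proof.
elim: s h => [|c s IH] h /=; first exact: measurable_cst.
apply: emeasurable_funD; last exact: IH.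
pose X w := (position A w h, position A w (rcons h c)).
pose G (u : M * M) := ((mdist u.1 u.2)%:E + (c u.2)%:num)%E.
apply: (@measurable_finite_range _ X G) => -[x y].
rewrite (_ : [set w | X w = (x, y)]%classic = ([set w | position A w h = x]
   `&` [set w | position A w (rcons h c) = y])%classic).
  by apply: measurableI; exact: measurable_position.
by apply/seteqP; split=> w /=; rewrite /X; [case=> -> ->|case=> -> ->].
Qed.

Lemma cost_alg_run s w : cost_alg A s w = run_cost (position A w) [::] s.
Proof. by rewrite /cost_alg -(serve_cost_run _ [::]) position_nil. Qed.

Variable P : probability Omega R.

Lemma measurable_eexpect g (F : seq (M * R) -> Omega -> \bar R) :
  (forall s, measurable_fun setT (F s)) ->
  measurable_fun setT (fun w => eexpect g (F^~ w)).
Proof.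
elim: g F => [|z v g IH|g IH k IHk] F mF /=; first exact: mF.
  by apply: (IH (fun s => F ((z, v) :: s))) => s; exact: mF.
apply: emeasurable_funM; last exact: measurable_cst.
by apply: emeasurable_funD; [exact: IH|exact: IHk].
Qed.

Lemma integral_eexpect g (F : seq (M * R) -> Omega -> \bar R) :
  (forall s, measurable_fun setT (F s)) -> (forall s w, 0 <= F s w)%E ->
  (\int[P]_w eexpect g (F^~ w) = eexpect g (fun s => \int[P]_w F s w))%E.
Proof.
elim: g F => [|z v g IH|g IH k IHk] F mF F0 //=.
  by rewrite (IH (fun s => F ((z, v) :: s))).
have m1 := measurable_eexpect g mF; have m2 := measurable_eexpect k mF.
have p1 w : (0 <= eexpect g (F^~ w))%E by apply: eexpect_ge0 => s.
have p2 w : (0 <= eexpect k (F^~ w))%E by apply: eexpect_ge0 => s.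
rewrite ge0_integralZr ?half_ge0 //.
- by rewrite ge0_integralD // IH // IHk.
- exact: emeasurable_funD.
- by move=> w _; rewrite adde_ge0.
Qed.

(** Yao's principle: exchange the expectation over the game with the integral over the random bits.
    Repeating the game makes the additive constant and the initial move negligible. *)
Lemma hard_competitive S rho r r' : 0 < r -> hard S rho r -> competitive P A r' ->
  r <= r'.
Proof.
move=> r0 HS [c' Hc].
pose V := Num.max rho 0 + 1.
have V0 : 0 < V by rewrite ltr_wpDl // le_max lexx orbT.
have rhoV : rho <= V by rewrite /V ler_wpDr // le_max lexx.
have [[g b] /= [bS Hon Hoff _]] := HS S V (fintype.subxx S) rhoV V0.
(* [r'] may be negative, while the bound on [cost_opt] has to be multiplied by a nonnegative
   factor. *)
pose rp := Num.max r' 0; have rp0 : 0 <= rp by rewrite le_max lexx orbT.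
pose gs := fix gs n := if n is n'.+1 then seqg g (gs n') else Stop M.
have Hlow n : lower S (fun=> 0) (gs n) (fun=> n%:R * V).
  elim: n => [|n IH] /=; first by move=> x _; rewrite mul0r.
  apply: lower_seq IH; apply: lower_le (Hon (fun=> n%:R * V) _ _ _) => //.
  - by move=> x Sx; rewrite /raise_on Sx mulr1 -natr1 mulrDl mul1r.
  - by move=> x y _ _; rewrite lerDl mdist_ge0.
  - by move=> x y Sx Sy; rewrite /raise_on Sx Sy lerDl mdist_ge0.
have Hup n : off S (gs n) b b <= n%:R * (V / r).
  elim: n => [|n IH] /=; first by rewrite mul0r off_Stop.
  apply: le_trans (off_seq _ _ _ bS bS) _.
  by rewrite -natr1 mulrDl mul1r addrC lerD.
(* The initial task is free on [S] and infinite elsewhere, which brings the algorithm into [S]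
   before the game starts. *)
pose g0 n := Play b 0 (gs n).
pose F s w := cost_alg A (map (task_of S) s) w.
have mF s : measurable_fun setT (F s).
  rewrite /F; under eq_fun do rewrite cost_alg_run.
  exact: measurable_run_cost.
have F0 s w : (0 <= F s w)%E by rewrite /F cost_alg_run run_cost_ge0.
have main n : n%:R * V <= rp * (mdist v0 b + n%:R * (V / r)) + c'.
  have L : ((n%:R * V)%:E <= eexpect (g0 n) (fun s => \int[P]_w F s w))%E.
    rewrite -integral_eexpect //.
    have <- : (\int[P]_w cst (n%:R * V)%:E w = (n%:R * V)%:E)%E.
      rewrite integral_cst //; apply: (etrans (congr1 (mule (n%:R * V)%:E) (probability_setT P))).
      by rewrite mule1.
    apply: ge0_le_integral => //.
    - by move=> w _; rewrite lee_fin mulr_ge0 // ltW.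
    - exact: measurable_eexpect.
    move=> w _ /=; set c := task_of S (b, 0).
    rewrite /F; under [X in eexpect _ X]eq_fun do rewrite cost_alg_run /=.
    rewrite -/c; rewrite eexpectDl; last by move=> s; exact: run_cost_ge0.
      rewrite task_ofE; case: ifP => Sy.
        apply: le_trans (lower_run_cost (Hlow n) Sy) _.
        rewrite leeDr // adde_ge0 // lee_fin ?mdist_ge0 //.
        exact: pcost_ge0.
      rewrite addey // addye ?leey // gt_eqF //.
      apply: (@lt_le_trans _ _ 0%E) => //.
      by apply: eexpect_ge0 => s; exact: run_cost_ge0.
    by rewrite adde_ge0 // lee_fin mdist_ge0.
  have U : (eexpect (g0 n) (fun s => \int[P]_w F s w)
      <= (rp * (mdist v0 b + off S (gs n) b b) + c')%:E)%E.
    have -> : rp * (mdist v0 b + off S (gs n) b b) + c'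
       = expect (gs n) (fun s => rp * mdist v0 b + c' + rp * opt S b s b).
      rewrite expectD expect_cst /off; have -> : forall h (f : seq (M * R) -> R),
        expect h (fun s => rp * f s) = rp * expect h f.
        by elim=> //= h IH k IHk f; rewrite IH IHk; field.
      by ring.
    rewrite -eexpect_EFin /=; apply: eexpect_le => s.
    apply: le_trans (Hc _) _.
    have -> : rp * mdist v0 b + c' + rp * opt S b s b
       = rp * (mdist v0 b + opt S b s b) + c' by ring.
    rewrite EFinD leeD // EFinM.
    apply: le_trans (_ : (rp%:E * cost_opt v0 (map (task_of S) ((b, 0%R) :: s)) <= _)%E).
      by rewrite lee_wpmul2r ?cost_opt_ge0 // lee_fin le_max lexx.
    rewrite lee_wpmul2l ?lee_fin //; apply: cost_opt_le => //.
    by rewrite /pcost eqxx normr0.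
  have := le_trans L U; rewrite lee_fin => /le_trans; apply.
  by rewrite lerD2r ler_wpM2l // lerD2l.
suff : r <= rp by rewrite le_max => /orP[//|]; rewrite leNgt r0.
rewrite leNgt; apply/negP => rpr.
(* The contradiction gains [e] per repetition, so [n] is chosen to make [n * e] exceed the constant
   terms. *)
pose e := V * (1 - rp / r).
have e0 : 0 < e by rewrite mulr_gt0 // subr_gt0 ltr_pdivrMr // mul1r.
pose n := (Num.truncn (`|rp * mdist v0 b + c'| / e)).+1.
have := main n.
have : `|rp * mdist v0 b + c'| < n%:R * e.
  rewrite -ltr_pdivrMr //.
  by have /andP[] := truncn_itv (divr_ge0 (normr_ge0 (rp * mdist v0 b + c')) (ltW e0)).
have := ler_norm (rp * mdist v0 b + c').
have -> : n%:R * e = n%:R * V - rp * (n%:R * (V / r)).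
  by rewrite /e; field; rewrite gt_eqF.
clear; lra.
Qed.

End Measurability.

End Link.

(** * Weighted clusters and their merging *)

Lemma pairwise_perm (T : eqType) (r : rel T) (s1 s2 : seq T) : symmetric r ->
  perm_eq s1 s2 -> pairwise r s1 -> pairwise r s2.
Proof.
move=> sym_r; elim: s2 s1 => [|x s2 IH] s1 p12 r1 //=.
have xs1 : x \in s1 by rewrite (perm_mem p12) mem_head.
have p2 : perm_eq (rem x s1) s2.
  by rewrite -(perm_cons x) perm_sym (perm_trans _ (perm_to_rem xs1)) // perm_sym.
have /andP[h1 h2] : all (r x) (rem x s1) && pairwise r (rem x s1).
  elim: s1 {p12 p2} r1 xs1 => //= y s1 IHs /andP[ys r1].
  rewrite inE eq_sym; case: eqVneq => [<- _|yx /= xs1]; first by rewrite ys.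
  have /andP[-> ->] := IHs r1 xs1; rewrite !andbT sym_r (allP ys) //=.
  by apply/allP => z /mem_rem; exact: (allP ys).
by rewrite (IH _ p2 h2) andbT -(perm_all _ p2).
Qed.

Section Weights.
Variable R : realType.

(** Telescoping: [1 / (j + 1)^2] is at most [1 / j - 1 / (j + 1)]. *)
Lemma sum_inv_sqr_le (k : nat -> R) (Q : R) L : (0 < L)%N -> 0 <= Q ->
  (forall j, (0 < j < L)%N -> j.+1%:R ^+ 2 * k j <= Q) ->
  \sum_(1 <= j < L) k j <= Q * (1 - L%:R^-1).
Proof.
move=> L0 Q0; elim: L L0 => // -[_ _ _|L IH _ Hk].
  by rewrite big_geq // invr1 subrr mulr0.
rewrite big_nat_recr //=.
have /IH {}IH : (0 < L.+1)%N by [].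
have {}IH := IH (fun j jL => Hk j ltac:(lia)).
have := Hk L.+1 ltac:(lia).
set a : R := L.+1%:R; have a0 : 0 < a by rewrite ltr0n.
have -> : L.+2%:R = a + 1 :> R by rewrite natr1.
move=> H; have {}H : k L.+1 <= Q / (a + 1) ^+ 2.
  by rewrite ler_pdivlMr ?exprn_gt0 ?addr_gt0 // mulrC.
apply: le_trans (lerD IH H) _.
rewrite -mulrDr ler_wpM2l //.
have -> : 1 - (a + 1)^-1 = 1 - a^-1 + (a * (a + 1))^-1.
  by field; rewrite !gt_eqF // addr_gt0.
rewrite lerD2l lef_pV2 ?posrE ?mulr_gt0 ?exprn_gt0 ?addr_gt0 //.
by rewrite expr2 ler_pM2r ?addr_gt0 // lerDl.
Qed.

(** If every [m] failed, [sum_inv_sqr_le] would bound the positive sum by strictly less than itself.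
    This trades unequal weights for [m] clusters of weight at least [k m], once [k] is
    decreasing. *)
Lemma heavy_prefix (k : nat -> nat) L : (1 < L)%N ->
  (forall j, (0 < j < L)%N -> (0 < k j)%N) ->
  exists2 m, (0 < m < L)%N & (\sum_(1 <= j < L) k j <= m.+1 ^ 2 * k m)%N.
Proof.
move=> L1 k0; set Q := (\sum_(1 <= j < L) k j)%N.
have [[m mL Hm]|none] := pselect (exists2 m, (0 < m < L)%N & (Q <= m.+1 ^ 2 * k m)%N).
  by exists m.
exfalso.
have H j : (0 < j < L)%N -> j.+1%:R ^+ 2 * (k j)%:R <= Q%:R :> R.
  move=> jL; rewrite -natrX -natrM ler_nat leqNgt; apply/negP => /ltnW Hj.
  by apply: none; exists j.
have := sum_inv_sqr_le (ltnW L1) (ler0n R Q) H.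
rewrite -natr_sum -/Q -subr_ge0 mulrBr mulr1 addrAC subrr add0r oppr_ge0.
rewrite leNgt mulr_gt0 // ?invr_gt0 ?ltr0n ?(ltnW L1) //.
rewrite /Q big_ltn // addn_gt0 k0 //; lia.
Qed.

End Weights.

Section Clusters.
Variables (R : realType) (M : finMetricType R).
Variables (A w : R) (n tau : nat).
Hypothesis A2 : 2 <= A.
Hypothesis w0 : 0 < w.

Definition scale (l : nat) : R := w * 2 ^+ l.

Lemma scale_gt0 l : 0 < scale l.
Proof. by rewrite mulr_gt0 ?exprn_gt0. Qed.

Definition apart (delta : R) (c c' : {set M} * nat) :=
  [forall x in c.1, forall y in c'.1, delta <= mdist x y].

Lemma apart_sym delta : symmetric (apart delta).
Proof.
move=> c c'; apply/idP/idP => /forall_inP H; apply/forall_inP => x xc;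
  apply/forall_inP => y yc; rewrite metric_sym; exact: (forall_inP (H y yc)).
Qed.

Definition clustered l (P : {set M}) s := exists cl : seq ({set M} * nat),
  [/\ (\sum_(c <- cl) c.2)%N = s, pairwise (apart (12 * scale l / A)) cl &
   forall c, c \in cl -> [/\ c.1 \subset P, (0 < c.2)%N &
     hard c.1 (2 * scale l / A) (rate A c.2)]].

Let kap : R := (32 * A * (1 + ln n%:R)) ^+ 2.

(** Sort the clusters by decreasing weight and keep the [m.+1] heaviest, with [m] from
    [heavy_prefix]. Then [hard_node] multiplies the weight [k 0] inside the logarithm by
    [1 + m.+1 ^ 2 * (k m / k 0)], which yields at least [s]. A lone cluster is kept as it is. *)
Lemma collapse l (P : {set M}) s : {in P &, forall x y, mdist x y <= scale l} ->
  (0 < s <= n)%N -> clustered l P s ->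
  exists2 S : {set M}, S \subset P & hard S (kap * scale l) (rate A s).
Proof.
move=> diamP /andP[s0 sn] [cl0 [sum0 sep0 H0]].
have A0 : 0 < A by exact: lt_le_trans A2.
pose leT (c c' : {set M} * nat) := (c'.2 <= c.2)%N.
pose cl := sort leT cl0.
have pcl : perm_eq cl cl0 by rewrite perm_sort.
have sumcl : (\sum_(c <- cl) c.2)%N = s by rewrite (perm_big _ pcl).
have sepcl : pairwise (apart (12 * scale l / A)) cl.
  by apply: (pairwise_perm (@apart_sym _)) sep0; rewrite perm_sym.
have Hcl c : c \in cl -> [/\ c.1 \subset P, (0 < c.2)%N &
     hard c.1 (2 * scale l / A) (rate A c.2)] by rewrite (perm_mem pcl); exact: H0.
have sorted_cl : sorted leT cl by apply: sort_sorted => c c'; exact: leq_total.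
have leT_tr : transitive leT by move=> c c' c'' h1 h2; exact: leq_trans h2 h1.
have c0 : {set M} * nat := (finset.set0, 0%N).
pose T i := (nth c0 cl i).1; pose k i := (nth c0 cl i).2.
have HT i : (i < size cl)%N -> [/\ T i \subset P, (0 < k i)%N &
  hard (T i) (2 * scale l / A) (rate A (k i))] by move=> il; apply: Hcl; rewrite mem_nth.
have kmono i j : (i <= j < size cl)%N -> (k j <= k i)%N.
  move=> /andP[ij jl].
  by apply: (sorted_leq_nth leT_tr (fun c => leqnn _) c0 sorted_cl) => //;
    rewrite inE //; lia.
have sumk : (\sum_(0 <= i < size cl) k i)%N = s by rewrite -sumcl (big_nth c0).
have cl_gt0 : (0 < size cl)%N.
  by move: s0; rewrite -sumk; case: (size cl) => //; rewrite big_geq.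
have sepT i j : (i < size cl)%N -> (j < size cl)%N -> i != j ->
    {in T i & T j, forall x y, 12 * scale l / A <= mdist x y}.
  wlog ij : i j / (i < j)%N => [Hw il jl|il jl _ x y xi yj].
    rewrite neq_ltn => /orP[ij|ji]; first by apply: Hw => //; rewrite neq_ltn ij.
    move=> x y xi yj; rewrite metric_sym.
    by apply: (Hw j i ji jl il) => //; rewrite neq_ltn ji.
  have /(pairwiseP c0)/(_ i j il jl ij) /forall_inP/(_ x xi)/forall_inP := sepcl.
  exact.
have kap1 : 2 / A <= kap.
  have L1 : 1 <= 1 + ln n%:R :> R by rewrite lerDl ln_nat_ge0.
  apply: le_trans (_ : 1 <= _); first by rewrite ler_pdivrMr ?mul1r.
  rewrite exprn_ege1 // -[leLHS]mulr1; apply: ler_pM => //.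
  by have := A2; lra.
have [cl1|cl1] := leqP (size cl) 1.
  have [TP k0 HT0] := HT 0%N cl_gt0; exists (T 0%N) => //.
  have <- : k 0%N = s.
    rewrite -sumk (_ : size cl = 1%N) ?big_nat1 //.
    by apply/eqP; rewrite eqn_leq cl1.
  apply: hard_le HT0 => //; last exact: lt_le_trans (rate_ge1 _ A0).
  by rewrite mulrAC ler_pM2r ?scale_gt0.
have [m /andP[m0 mL] Hm] := heavy_prefix R cl1
  (fun j jL => let: And3 _ h _ := HT j (proj2 (andP jL)) in h).
have [_ km0 _] := HT m mL; have [_ k00 _] := HT 0%N cl_gt0.
have sE : s = (k 0%N + \sum_(1 <= j < size cl) k j)%N by rewrite -sumk big_ltn.
have Lk : (size cl <= s)%N.
  rewrite -sumk -[leqLHS]subn0 -[leqLHS]muln1 -sum_nat_const_nat.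
  rewrite !big_nat; apply: leq_sum => i /andP[_ il].
  by have [] := HT i il.
have mn : (0 < m < n)%N by rewrite m0 /=; exact: leq_trans (leq_trans mL Lk) sn.
have ordL (i : 'I_m.+1) : (i < size cl)%N by exact: leq_trans (ltn_ord i) mL.
exists (\bigcup_(i < m.+1) T i).
  by apply/bigcupsP => i _; have [] := HT i (ordL i).
have km_le : (k m <= k 0%N)%N by apply: kmono; rewrite leq0n.
have rate0 j : 0 < rate A j by exact: lt_le_trans (rate_ge1 j A0).
apply: hard_le (lexx _) (rate0 s) _ (@hard_node _ _ _ _ A (scale l)
    (2 * scale l / A) (k 0%N) (k m) n _ (scale_gt0 l) (lexx _) _ _ _ _ _ _ _) => //.
- rewrite [leLHS]/rate [X in _ <= X + _]/rate -addrA lerD2l -mulrDr.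
  apply: ler_wpM2l; first by rewrite divr_ge0 ?ltW ?gain_cst_gt0.
  have K0 : 0 < (k 0%N)%:R :> R by rewrite ltr0n.
  have y0 : 0 < 1 + m.+1%:R ^+ 2 * ((k m)%:R / (k 0%N)%:R) :> R.
    by rewrite ltr_wpDr // mulr_ge0 ?exprn_ge0 // divr_ge0.
  rewrite -lnM ?posrE // ler_ln ?posrE ?ltr0n ?mulr_gt0 //.
  have -> : (k 0%N)%:R * (1 + m.+1%:R ^+ 2 * ((k m)%:R / (k 0%N)%:R))
     = (k 0%N + m.+1 ^ 2 * k m)%N%:R :> R.
    by rewrite natrD natrM natrX; field; rewrite gt_eqF.
  by rewrite ler_nat sE leq_add2l.
- by move=> i j ij; apply: sepT => //; exact: ordL.
- move=> i j x y xi yj; apply: diamP.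
    by have [/fintype.subsetP + _ _] := HT i (ordL i); apply.
  by have [/fintype.subsetP + _ _] := HT j (ordL j); apply.
- by rewrite sE in sn; exact: leq_trans (leq_addr _ _) sn.
- move=> i; have [_ ki0 Hi] := HT i (ordL i).
  case: eqVneq => [i0|_]; first by rewrite i0 in Hi *.
  apply: hard_le Hi => //; apply: rate_le => //.
  by apply: kmono; rewrite -ltnS ltn_ord.
Qed.

Hypothesis tau_large : kap * A <= 2 * 2 ^+ tau.

(** The merged set is hard from [kap * scale l] on, and [tau_large] puts this below the threshold
    [2 * scale (l + tau) / A]. *)
Lemma clustered_up l (P : {set M}) s : {in P &, forall x y, mdist x y <= scale l} ->
  (0 < s <= n)%N -> clustered l P s -> clustered (l + tau) P s.
Proof.
move=> diamP sn cP; have A0 : 0 < A by exact: lt_le_trans A2.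
have [S SP HS] := collapse diamP sn cP; exists [:: (S, s)]; split=> //.
  by rewrite big_seq1.
move=> c; rewrite inE => /eqP -> /=; case/andP: sn => s0 _; split=> //.
apply: hard_le HS => //; last exact: lt_le_trans (rate_ge1 _ A0).
rewrite ler_pdivlMr // /scale exprD mulrAC.
have -> : 2 * (w * (2 ^+ l * 2 ^+ tau)) = 2 * 2 ^+ tau * (w * 2 ^+ l) by ring.
by rewrite ler_wpM2r // ltW // scale_gt0.
Qed.

Lemma clustered_sub l (P P' : {set M}) s : P \subset P' ->
  clustered l P s -> clustered l P' s.
Proof.
move=> PP' [cl [H1 H2 H3]]; exists cl; split=> // c /H3[h1 h2 h3]; split=> //.
exact: fintype.subset_trans h1 PP'.
Qed.

Lemma clusteredU l (P1 P2 : {set M}) s1 s2 :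
  {in P1 & P2, forall x y, 12 * scale l / A <= mdist x y} ->
  clustered l P1 s1 -> clustered l P2 s2 ->
  clustered l (P1 :|: P2) (s1 + s2).
Proof.
move=> sepP [cl1 [<- p1 H1]] [cl2 [<- p2 H2]]; exists (cl1 ++ cl2); split.
- by rewrite big_cat.
- rewrite pairwise_cat p1 p2 !andbT; apply/allrelP => c c' /H1[cP _ _] /H2[cP' _ _].
  apply/forall_inP => x xc; apply/forall_inP => y yc.
  by apply: sepP; [exact: (fintype.subsetP cP)|exact: (fintype.subsetP cP')].
move=> c; rewrite mem_cat => /orP[/H1|/H2] [h1 h2 h3]; split=> //;
  apply: fintype.subset_trans h1 _; [exact: finset.subsetUl|exact: finset.subsetUr].
Qed.

Lemma clustered_set1 l x : clustered l [set x] 1.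
Proof.
exists [:: ([set x], 1%N)]; split=> //; first by rewrite big_seq1.
move=> c; rewrite inE => /eqP -> /=; split=> //.
by rewrite /rate ln1 mulr0 addr0; exact: hard_set1.
Qed.

End Clusters.

(** * Splitting a finite metric space *)

(* If every step failed, then [n ^ (2 ^ i - 1) <= b i ^ (2 ^ i)] for all [i]. *)
Lemma slow_growth (b : nat -> nat) (n t : nat) : (0 < n)%N -> (0 < b 0)%N ->
  (2 * b t <= n)%N -> (n < 2 ^ (2 ^ t))%N ->
  exists2 i, (i < t)%N & (b i.+1 ^ 2 <= n * b i)%N.
Proof.
move=> n0 b0 bt nt.
have [[i it Hi]|none] := pselect (exists2 i, (i < t)%N & (b i.+1 ^ 2 <= n * b i)%N).
  by exists i.
exfalso.
have H i : (i <= t)%N -> (n ^ (2 ^ i).-1 <= b i ^ (2 ^ i))%N.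
  elim: i => [|i IH] it; first by rewrite expn0 expn0 expn1.
  have Hi : (n * b i <= b i.+1 ^ 2)%N.
    by rewrite leqNgt; apply/negP => /ltnW h; apply: none; exists i.
  have e0 : (0 < 2 ^ i)%N by rewrite expn_gt0.
  rewrite expnS expnM; apply: leq_trans (_ : (n * b i) ^ (2 ^ i) <= _)%N; last first.
    by rewrite leq_exp2r.
  rewrite expnMn; apply: leq_trans (_ : n ^ 2 ^ i * n ^ (2 ^ i).-1 <= _)%N.
    by rewrite -expnD; apply: eq_leq; congr (_ ^ _)%N; lia.
  by rewrite leq_mul2l IH ?orbT // ltnW.
have e0 : (0 < 2 ^ t)%N by rewrite expn_gt0.
have : (n ^ (2 ^ t).-1 * 2 ^ (2 ^ t) <= n ^ (2 ^ t).-1 * n)%N.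
  rewrite -expnSr prednK //; apply: leq_trans (_ : (2 * b t) ^ (2 ^ t) <= _)%N.
    by rewrite expnMn mulnC leq_mul2l H // orbT.
  by rewrite leq_exp2r.
by rewrite leq_pmul2l ?expn_gt0 ?n0 // leqNgt nt.
Qed.

Section Split.
Variables (R : realType) (M : finMetricType R).
Implicit Types (P : {set M}) (x y : M).

Definition cball P x (rho : R) := [set z in P | mdist x z <= rho].

(** The balls of radius [rad t < D / 2] around [x] and [y] are disjoint, so one of them holds at
    most half of [P]. By [slow_growth] some annulus around its center is thin: [P1] is the ball
    inside it, [P2] the points beyond it. *)
Lemma split_set P (D : R) x y t : x \in P -> y \in P -> 0 < D ->
  D <= mdist x y -> (#|P| < 2 ^ (2 ^ t))%N ->
  exists P1 P2 : {set M}, [/\ P1 \subset P, P2 \subset P,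
    (0 < #|P1|)%N /\ (0 < #|P2|)%N,
    {in P1 & P2, forall a b, D / (2 * t.+1%:R) <= mdist a b} &
    ((#|P| - #|P2|) ^ 2 <= #|P| * #|P1|)%N].
Proof.
move=> xP yP D0 Dxy nt.
have t0 : 0 < t.+1%:R :> R by rewrite ltr0n.
pose rad i : R := i%:R * (D / (2 * t.+1%:R)).
have radt : rad t < D / 2.
  rewrite /rad mulrA ltr_pdivrMr ?mulr_gt0 //.
  have -> : D / 2 * (2 * t.+1%:R) = t.+1%:R * D by field.
  by rewrite ltr_pM2r // ltr_nat.
have disj : [disjoint cball P x (rad t) & cball P y (rad t)].
  rewrite disjoint_subset; apply/fintype.subsetP => z; rewrite !inE => /andP[_ xz].
  apply/negP => /andP[_ yz].
  have := metric_triangle x z y; rewrite (metric_sym z y).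
  by move: xz yz Dxy radt; clear; lra.
have half : (2 * #|cball P x (rad t)| <= #|P|)%N \/ (2 * #|cball P y (rad t)| <= #|P|)%N.
  have : (#|cball P x (rad t)| + #|cball P y (rad t)| <= #|P|)%N.
    rewrite -cardsUI (eqP (_ : _ :&: _ == finset.set0)) ?finset.cards0 ?addn0; last first.
      by rewrite setI_eq0.
    by apply: subset_leq_card; apply/fintype.subsetP => z; rewrite !inE => /orP[] /andP[].
  set a := #|_|; set b := #|_| => h; lia.
have [c cP hc] : exists2 c, c \in P & (2 * #|cball P c (rad t)| <= #|P|)%N.
  by case: half => h; [exists x|exists y].
have c0 : (0 < #|cball P c (rad 0)|)%N.
  by apply/card_gt0P; exists c; rewrite !inE cP mdistxx /rad mul0r lexx.
have P0 : (0 < #|P|)%N by apply/card_gt0P; exists c.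
have [i it Hi] :=
  @slow_growth (fun i => #|cball P c (rad i)|) #|P| t P0 c0 hc nt.
have bmono j k : (j <= k)%N -> cball P c (rad j) \subset cball P c (rad k).
  move=> jk; apply/fintype.subsetP => z; rewrite !inE => /andP[-> h] /=.
  apply: le_trans h _; rewrite ler_wpM2r ?ler_nat //.
  by rewrite divr_ge0 ?mulr_ge0 ?ltW.
exists (cball P c (rad i)), (P :\: cball P c (rad i.+1)).
have sub j : cball P c (rad j) \subset P.
  by apply/fintype.subsetP => z; rewrite inE => /andP[].
have cD : #|P :\: cball P c (rad i.+1)| = (#|P| - #|cball P c (rad i.+1)|)%N.
  by rewrite cardsD (finset.setIidPr (sub i.+1)).
have cle : (#|cball P c (rad i.+1)| <= #|P|)%N by exact: subset_leq_card.
split.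
- exact: sub.
- exact: finset.subsetDl.
- split; first exact: leq_trans c0 (subset_leq_card (bmono 0%N i (leq0n i))).
  rewrite cD subn_gt0; have := subset_leq_card (bmono i.+1 t it).
  lia.
- move=> a b; rewrite !inE => /andP[_ ca] /andP[+ bP]; rewrite bP /= -ltNge => cb.
  have := metric_triangle c a b; move: ca cb; rewrite /rad -natr1.
  set u := D / _; clear; lra.
- by rewrite cD subKn.
Qed.

End Split.

(** In terms of square roots, [n - p2 <= sqrt n * a] and [p2 <= sqrt n * sqrt p2 <= sqrt n * b]; add
    up and divide by [sqrt n]. *)
Lemma sqrt_split (n p1 p2 a b : nat) : (p2 <= n)%N -> (p1 <= a ^ 2)%N ->
  (p2 <= b ^ 2)%N -> ((n - p2) ^ 2 <= n * p1)%N -> (n <= (a + b) ^ 2)%N.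
Proof.
move=> p2n pa pb H; rewrite leqNgt; apply/negP => ab.
have h1 : ((n - p2) ^ 2 <= n * a ^ 2)%N by apply: leq_trans H _; rewrite leq_mul2l pa orbT.
have h2 : (p2 ^ 2 <= n * b ^ 2)%N by rewrite -mulnn leq_mul.
have [k kE] : exists k, n = (p2 + k)%N by exists (n - p2)%N; lia.
have kk : (k ^ 2 <= n * a ^ 2)%N by move: h1; rewrite kE addKn.
have cross : (p2 * k <= n * (a * b))%N.
  rewrite -leq_sqr !expnMn mulnCA; apply: leq_trans (leq_mul h2 kk) _.
  by apply: eq_leq; ring.
have : (n ^ 2 <= n * (a + b) ^ 2)%N.
  rewrite {1}kE sqrnD sqrnD; lia.
have n0 : (0 < n)%N by lia.
by rewrite -mulnn leq_pmul2l // leqNgt ab.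
Qed.

(** * Weights for all residues of scales *)

Section Decomposition.
Variables (R : realType) (M : finMetricType R).
Variables (w : R) (n t tau : nat).
Implicit Types (P : {set M}) (x y : M).

Let A : R := 48 * t.+1%:R.
Hypothesis w0 : 0 < w.
Hypothesis w_le : forall x y, x != y -> w <= mdist x y.
Hypothesis n_lt : (n < 2 ^ (2 ^ t))%N.
Hypothesis tau0 : (0 < tau)%N.
Hypothesis tau_large : (32 * A * (1 + ln n%:R)) ^+ 2 * A <= 2 * 2 ^+ tau.

Lemma A_ge2 : 2 <= A.
Proof.
rewrite /A; have : 1 <= t.+1%:R :> R by rewrite ler1n.
by set u : R := t.+1%:R => h; lra.
Qed.

Lemma scale_mono l l' : (l <= l')%N -> scale w l <= scale w l'.
Proof. by move=> ll; rewrite ler_pM2l // ler_eXn2l // ltr1n. Qed.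

Lemma scale_unbounded (D : R) : exists e, D <= scale w e.
Proof.
exists (Num.truncn (`|D| / w)).+1; set e := _.+1.
have /andP[_ h] := truncn_itv (divr_ge0 (normr_ge0 D) (ltW w0)).
apply: le_trans (ler_norm D) _; move: (ltW h); rewrite ler_pdivrMr // mulrC.
move=> /le_trans; apply; rewrite ler_pM2l // -natrX ler_nat.
exact: ltnW (ltn_expl _ _).
Qed.

Lemma prod_add_max (j0 : 'I_tau) (s1 s2 : nat -> nat) :
  (\prod_(j < tau) s1 j + \prod_(j < tau) s2 j
   <= \prod_(j < tau) (if j == j0 :> nat then s1 j + s2 j else maxn (s1 j) (s2 j)))%N.
Proof.
have bigj (F : 'I_tau -> nat) :
    (\prod_j F j = F j0 * \prod_(j | j != j0) F j)%N by rewrite (bigD1 j0).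
rewrite !bigj /= eqxx mulnDl; apply: leq_add; rewrite leq_mul2l;
  apply/orP; right; apply: leq_prod => j jj0;
  by rewrite -(inj_eq val_inj) in jj0; rewrite (negbTE jj0) ?leq_maxl ?leq_maxr.
Qed.

(** Induction on the cardinality; [sqrt_split] and [prod_add_max] preserve the bound on the product.
    Clusters are only claimed at scales covering the diameter of [P], which also cover both
    parts. *)
Lemma decomposition P : (0 < #|P| <= n)%N -> exists s : nat -> nat,
  [/\ forall j, (0 < s j <= #|P|)%N, (#|P| <= (\prod_(j < tau) s j) ^ 2)%N &
   forall l, {in P &, forall x y, mdist x y <= scale w l} ->
     clustered A w l P (s (l %% tau)%N)].
Proof.
have [N] := ubnP #|P|; elim: N P => // N IH P PN /andP[P0 Pn].
have A2 := A_ge2.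
have [P1|P1] := leqP #|P| 1.
  have /cards1P[x PE] : #|P| == 1%N by rewrite eqn_leq P1.
  exists (fun=> 1%N); split=> [j||l _].
  - by rewrite PE cards1.
  - by rewrite PE cards1 prod_nat_const exp1n.
  - by rewrite PE; exact: clustered_set1.
have /card_gt0P[p0 p0P] := P0.
pose pr : M * M := [arg max_(u > (p0, p0) | (u.1 \in P) && (u.2 \in P)) mdist u.1 u.2]%O.
have [xP yP Hmax] : [/\ pr.1 \in P, pr.2 \in P &
    {in P &, forall a b, mdist a b <= mdist pr.1 pr.2}].
  rewrite /pr; case: arg_maxP => /=; first by rewrite p0P.
  move=> u /andP[u1 u2] H; split=> // a b aP bP.
  by apply: (H (a, b)); rewrite /= aP.
move: pr.1 pr.2 xP yP Hmax => x y xP yP Hmax.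
have wD : w <= mdist x y.
  have [a [b [aP bP ab]]] : exists a b, [/\ a \in P, b \in P & a != b].
    by have /card_gt1P[a [b [aP bP ab]]] := P1; exists a, b.
  exact: le_trans (w_le ab) (Hmax a b aP bP).
have D0 : 0 < mdist x y by exact: lt_le_trans wD.
have [Q1 [Q2 [Q1P Q2P [Q10 Q20] sepQ cardQ]]] :=
  split_set xP yP D0 (lexx _) (leq_ltn_trans Pn n_lt).
have disjQ : [disjoint Q1 & Q2].
  rewrite disjoint_subset; apply/fintype.subsetP => z z1; rewrite inE; apply/negP => z2.
  have := sepQ z z z1 z2; rewrite mdistxx leNgt divr_gt0 // mulr_gt0 //.
have cQ : (#|Q1| + #|Q2| <= #|P|)%N.
  rewrite -cardsUI (eqP (_ : Q1 :&: Q2 == finset.set0)) ?finset.cards0 ?addn0.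
    by apply: subset_leq_card; rewrite finset.subUset Q1P.
  by rewrite setI_eq0.
have [q1N q1n q2N q2n] : [/\ #|Q1| < N, 0 < #|Q1| <= n, #|Q2| < N & 0 < #|Q2| <= n]%N.
  move: cQ Q10 Q20 PN Pn; clear.
  by move: #|Q1| #|Q2| #|P| => q1 q2 p *; split; lia.
have [s1 [s1P s1prod s1cl]] := IH Q1 q1N q1n.
have [s2 [s2P s2prod s2cl]] := IH Q2 q2N q2n.
have exE : exists e, mdist x y <= scale w e by exact: scale_unbounded.
(* Minimality of [e] makes [scale w e] at most twice the diameter, and every scale to be treated is
   at least [e]. *)
case: (ex_minnP exE) => e De emin.
have e_half : scale w e <= 2 * mdist x y.
  case: e De emin => [|e] De emin; first by rewrite /scale expr0 mulr1; lra.
  rewrite /scale exprS mulrCA ler_pM2l // leNgt; apply/negP => /ltW /emin.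
  by rewrite ltnn.
have dQ (Q : {set M}) l : Q \subset P -> {in P &, forall x y, mdist x y <= scale w l} ->
    {in Q &, forall x y, mdist x y <= scale w l}.
  by move=> QP H a b aQ bQ; apply: H; apply: (fintype.subsetP QP).
pose s j := if j == (e %% tau)%N then (s1 j + s2 j)%N else maxn (s1 j) (s2 j).
have s_bd j : (0 < s j <= #|P|)%N.
  have := s1P j; have := s2P j; rewrite /s; move: cQ; clear.
  by case: ifP => _; move: #|Q1| #|Q2| #|P| (s1 j) (s2 j) => q1 q2 p a b; lia.
exists s; split=> //.
  apply: leq_trans (_ : (\prod_(j < tau) s1 j + \prod_(j < tau) s2 j) ^ 2 <= _)%N.
    apply: sqrt_split s1prod s2prod cardQ; exact: subset_leq_card.
  rewrite leq_sqr; exact: (prod_add_max (Ordinal (ltn_pmod e tau0))).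
move=> l Hl.
have el : (e <= l)%N by apply: emin; apply: Hl.
have c1 := s1cl l (dQ _ _ Q1P Hl); have c2 := s2cl l (dQ _ _ Q2P Hl).
rewrite /s; case: eqVneq => [le_mod|_]; last first.
  by rewrite /maxn; case: ifP => _; [exact: clustered_sub Q2P c2|exact: clustered_sub Q1P c1].
rewrite le_mod {c1 c2}.
have [i ->] : exists i, l = (e + i * tau)%N.
  exists ((l - e) %/ tau)%N; have /dvdnP[q qE] : (tau %| l - e)%N.
    by rewrite -eqn_mod_dvd // le_mod.
  by rewrite qE mulnK // -qE subnKC.
have diamP k : (e <= k)%N -> {in P &, forall x y, mdist x y <= scale w k}.
  by move=> ek a b aP bP; apply: le_trans (Hmax a b aP bP) (le_trans De (scale_mono ek)).
(* At scale [e] the clusters of both parts are put side by side; each further [tau] scales they are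
   merged and carried up. *)
elim: i => [|i IHi]; last first.
  rewrite mulSn [(tau + _)%N]addnC addnA.
  apply: (clustered_up A2 w0 tau_large _ _ IHi); first by apply: diamP; exact: leq_addr.
  have := s_bd (e %% tau)%N; rewrite /s eqxx => /andP[-> /= h].
  exact: leq_trans h Pn.
rewrite mul0n addn0; apply: (@clustered_sub _ _ _ _ _ (Q1 :|: Q2)).
  by rewrite finset.subUset Q1P.
apply: clusteredU.
- move=> a b aQ bQ; apply: le_trans (sepQ a b aQ bQ).
  (* The factor 48 in [A] turns the separation into [24 * mdist x y], which covers
     [12 * scale w e]. *)
  rewrite /A; have t0 : 0 < t.+1%:R :> R by rewrite ltr0n.
  rewrite ler_pdivrMr ?mulr_gt0 //.
  have -> : mdist x y / (2 * t.+1%:R) * (48 * t.+1%:R) = 24 * mdist x y.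
    by field; rewrite gt_eqF.
  by have := e_half; lra.
- by apply: s1cl; apply: dQ Q1P _; exact: diamP.
- by apply: s2cl; apply: dQ Q2P _; exact: diamP.
Qed.

End Decomposition.

(** * Choice of the parameters and conclusion *)

Section Final.
Variable R : realType.

Lemma min_dist (M : finMetricType R) :
  exists2 w : R, 0 < w & forall x y : M, x != y -> w <= mdist x y.
Proof.
have [[u0 u0P]|none] := pselect (exists u : M * M, u.1 != u.2).
  pose u := [arg min_(u < u0 | u.1 != u.2) mdist u.1 u.2]%O.
  have [uP umin] : u.1 != u.2 /\ forall x y : M, x != y -> mdist u.1 u.2 <= mdist x y.
    rewrite /u; case: arg_minP => //= v vP H; split=> // x y xy.
    exact: (H (x, y)).
  by exists (mdist u.1 u.2); rewrite ?mdist_gt0.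
by exists 1 => // x y xy; case: none; exists (x, y).
Qed.

Lemma ln_prod_nat tau (s : nat -> nat) : (forall j, (0 < s j)%N) ->
  ln (\prod_(j < tau) s j)%N%:R = \sum_(j < tau) ln (s j)%:R :> R.
Proof.
move=> s0; elim: tau => [|tau IH]; first by rewrite !big_ord0 ln1.
rewrite !big_ord_recr /= natrM lnM ?IH // posrE ltr0n //.
by rewrite prodn_gt0.
Qed.

(** Up to constants, [T = 2 ^ (t + 1)] dominates both [t.+1] and [1 + ln n], so the left side is at
    most [2 ^ (28 + 5 * t.+1)]. *)
Lemma tau_large_enough (n t : nat) : (0 < n)%N -> (n < 2 ^ (2 ^ t))%N ->
  (32 * (48 * t.+1%:R) * (1 + ln n%:R)) ^+ 2 * (48 * t.+1%:R)
  <= 2 * 2 ^+ (32 * t.+1) :> R.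
Proof.
move=> n0 nt; set T : R := 2 ^+ t.+1.
have T1 : 1 <= T by rewrite exprn_ege1 // ler1n.
have tT : t.+1%:R <= T by rewrite /T -natrX ler_nat ltnW // ltn_expl.
have l0 := ln_nat_ge0 R n.
have lT : 1 + ln n%:R <= T.
  have ln2 : ln 2 <= 1 :> R.
    have := @le_ln1Dx R 1 ltac:(lra); rewrite -[1 + 1]/2; exact.
  have : ln n%:R <= 2 ^+ t :> R.
    apply: le_trans (_ : ln (2 ^+ (2 ^ t)) <= _).
      by rewrite ler_ln ?posrE ?ltr0n ?exprn_gt0 // -natrX ler_nat ltnW.
    by rewrite lnXn // -[ln 2 *+ _]mulr_natl natrX -[leRHS]mulr1 ler_wpM2l.
  have : 1 <= 2 ^+ t :> R by rewrite exprn_ege1 // ler1n.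
  rewrite /T exprS; set u := 2 ^+ t; lra.
have t0 : 0 <= t.+1%:R :> R by [].
have L0 : 0 <= 1 + ln n%:R :> R by rewrite addr_ge0.
have T0 : 0 <= T by exact: le_trans T1.
have A_le : 48 * t.+1%:R <= 2 ^+ 6 * T.
  apply: ler_pM => //; lra.
have B_le : 32 * (48 * t.+1%:R) * (1 + ln n%:R) <= 2 ^+ 11 * T ^+ 2.
  have -> : 2 ^+ 11 * T ^+ 2 = 2 ^+ 5 * (2 ^+ 6 * T) * T :> R by ring.
  by apply: ler_pM => //; lra.
apply: le_trans (_ : (2 ^+ 11 * T ^+ 2) ^+ 2 * (2 ^+ 6 * T) <= _).
  apply: ler_pM => //; rewrite ?exprn_ge0 ?mulr_ge0 //.
  by rewrite lerXn2r ?nnegrE ?mulr_ge0 ?exprn_ge0.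
have -> : (2 ^+ 11 * T ^+ 2) ^+ 2 * (2 ^+ 6 * T) = 2 ^+ (28 + 5 * t.+1) :> R.
  by rewrite exprD [(5 * _)%N]mulnC exprM -/T; ring.
rewrite -exprS ler_eXn2l ?ltr1n //; lia.
Qed.

(** [t] is one more than the rounded iterated binary logarithm. Bases are changed by
    [1/2 <= ln 2 <= 1], and the hypothesis absorbs the additive constants. *)
Lemma loglog_bound (n : nat) : 1 <= ln (ln n%:R) :> R ->
  exists2 t, (n < 2 ^ (2 ^ t))%N & t.+1%:R <= 6 * ln (ln n%:R) :> R.
Proof.
move=> ll1.
have l1 : 1 < ln n%:R :> R.
  rewrite ltNge; apply/negP => h.
  have : ln (ln n%:R) <= 0 :> R by apply: ln_le0.
  lra.
have n2 : (1 < n)%N.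
  rewrite ltnNge; apply/negP => n1.
  by have : ln n%:R <= 0 :> R; [rewrite ln_le0 // lern1|lra].
have n0 : (0 < n)%N by exact: ltnW.
pose a := trunc_log 2 n; have a0 : (0 < a)%N by rewrite trunc_log_gt0 // n2.
exists (trunc_log 2 a).+1.
  apply: leq_trans (trunc_log_ltn n (ltnSn 1)) _.
  by rewrite leq_exp2l //; exact: trunc_log_ltn.
have ln2h : 2^-1 <= ln 2 :> R.
  have := @le_ln1Dx R (- 2^-1) ltac:(lra).
  have -> : 1 + - 2^-1 = 2^-1 :> R by field.
  by rewrite lnV ?posrE //; lra.
have ln2l : ln 2 <= 1 :> R.
  have := @le_ln1Dx R 1 ltac:(lra); rewrite -[1 + 1]/2; exact.
have la : a%:R <= 2 * ln n%:R :> R.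
  have : a%:R * ln 2 <= ln n%:R :> R.
    rewrite mulr_natl -lnXn // ler_ln ?posrE ?exprn_gt0 ?ltr0n //.
    by rewrite -natrX ler_nat trunc_logP.
  have : a%:R * 2^-1 <= a%:R * ln 2 :> R by rewrite ler_wpM2l.
  lra.
have lb : (trunc_log 2 a)%:R <= 2 * ln a%:R :> R.
  have : (trunc_log 2 a)%:R * ln 2 <= ln a%:R :> R.
    rewrite mulr_natl -lnXn // ler_ln ?posrE ?exprn_gt0 ?ltr0n //.
    by rewrite -natrX ler_nat trunc_logP.
  have : (trunc_log 2 a)%:R * 2^-1 <= (trunc_log 2 a)%:R * ln 2 :> R.
    by rewrite ler_wpM2l.
  lra.
have lc : ln a%:R <= ln 2 + ln (ln n%:R) :> R.
  by rewrite -lnM ?posrE //; [rewrite ler_ln ?posrE ?ltr0n ?mulr_gt0 //|]; lra.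
rewrite -2!natr1; lra.
Qed.

End Final.

Theorem theorem2p4 (R : realType) :
  exists (c : R) (n0 : nat), 0 < c /\
    forall (n : nat) (M : finMetricType R), (n0 <= n)%N -> #|M| = n ->
    forall (v0 : M) (d : measure_display) (Omega : measurableType d)
      (P : probability Omega R) (A : randomized_online_algorithm v0 Omega)
      (r : R),
      competitive P A r ->
      c * (ln n%:R / ln (ln n%:R) ^+ 2) <= r.
Proof.
(* 48 comes from [A], 64 from twice the factor 32 in [tau], and 36 from squaring
   [t.+1 <= 6 * ln (ln n)]. The threshold on [n] makes [ln (ln n)] at least 1. *)
exists (gain_cst R / 48 / 64 / 36), (Num.truncn (expR (expR (1 : R)))).+1.
split; first by rewrite !divr_gt0 ?gain_cst_gt0.
move=> n M n0n cardM v0 d Omega P alg r comp.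
have ee_n : expR (expR 1) <= n%:R :> R.
  have /andP[_ h] := truncn_itv (expR_ge0 (expR (1 : R))).
  by apply: le_trans (ltW h) _; rewrite ler_nat.
have n0 : (0 < n)%N by exact: leq_trans n0n.
have ln_n : expR 1 <= ln n%:R :> R.
  by rewrite -ler_expR lnK ?posrE ?ltr0n.
have ll1 : 1 <= ln (ln n%:R) :> R.
  by rewrite -ler_expR lnK // posrE (lt_le_trans _ ln_n) ?expR_gt0.
have [t nt t_le] := loglog_bound ll1.
have [w w0 w_le] := min_dist M.
pose tau := (32 * t.+1)%N; have tau0 : (0 < tau)%N by [].
pose A : R := 48 * t.+1%:R.
have A0 : 0 < A by rewrite mulr_gt0 // ltr0n.
have Ttau := tau_large_enough R n0 nt.
have cardT : #|[set: M]| = n by rewrite cardsT.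
have [s [s_bd s_prod s_cl]] : exists s : nat -> nat,
    [/\ forall j, (0 < s j <= #|[set: M]|)%N,
        (#|[set: M]| <= (\prod_(j < tau) s j) ^ 2)%N &
     forall l, {in [set: M] &, forall x y, mdist x y <= scale w l} ->
       clustered A w l [set: M] (s (l %% tau)%N)].
  by apply: (decomposition w0 w_le nt tau0 Ttau); rewrite cardT n0 leqnn.
have rate_r j : (j < tau)%N -> rate A (s j) <= r.
  move=> jtau.
  have [e He] : exists e, forall x y : M, mdist x y <= scale w e.
    have [e He] := scale_unbounded w0 (\sum_(u : M * M) mdist u.1 u.2).
    exists e => x y; apply: le_trans He; rewrite (bigD1 (x, y)) //= lerDl.
    by apply: sumr_ge0 => u _; exact: mdist_ge0.
  (* A scale of residue [j] that covers the whole space. *)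
  pose l := (j + e * tau)%N.
  have lj : (l %% tau = j)%N by rewrite /l addnC modnMDl modn_small.
  have dl : {in [set: M] &, forall x y, mdist x y <= scale w l}.
    move=> x y _ _; apply: le_trans (He x y) (scale_mono w0 _).
    by rewrite /l; apply: leq_trans (leq_addl _ _); exact: leq_pmulr.
  have := s_cl l dl; rewrite lj => cl_j.
  have sj : (0 < s j <= n)%N by have := s_bd j; rewrite cardT.
  have [S _ HS] := collapse (A_ge2 R t) w0 dl sj cl_j.
  apply: hard_competitive HS comp.
  exact: lt_le_trans (rate_ge1 _ A0).
have c0 := gain_cst_gt0 R.
(* Sum over the residues: the logarithms of the weights add up to at least half of [ln n]. *)
have sum_r : gain_cst R / A * ln n%:R <= 2 * (tau%:R * r).
  apply: le_trans (_ : 2 * \sum_(j < tau) (gain_cst R / A * ln (s j)%:R) <= _).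
    rewrite -mulr_sumr -ln_prod_nat; last by move=> j; case/andP: (s_bd j).
    rewrite mulrCA; apply: ler_wpM2l; first by rewrite divr_ge0 ?ltW.
    have pp : (0 < \prod_(j < tau) s j)%N.
      by rewrite prodn_gt0 // => j; case/andP: (s_bd j).
    rewrite mulr_natl -lnXn ?ltr0n // -natrX; apply: ler_ln_nat => //.
    by rewrite -cardT.
  rewrite ler_pM2l //.
  apply: le_trans (_ : \sum_(j < tau) r <= _).
    apply: ler_sum => j _; apply: le_trans (rate_r j (ltn_ord j)).
    by rewrite /rate lerDr.
  by rewrite sumr_const card_ord mulr_natl.
have r0 : 0 <= r by apply: le_trans (rate_r 0%N tau0); exact: le_trans ler01 (rate_ge1 _ A0).
have L0 : 0 < ln (ln n%:R) :> R by exact: lt_le_trans ll1.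
have T0 : 0 < t.+1%:R :> R by rewrite ltr0n.
have key : gain_cst R * ln n%:R <= 48 * 64 * t.+1%:R ^+ 2 * r.
  move: sum_r; rewrite mulrAC ler_pdivrMr // natrM.
  have -> // : 2 * (32 * t.+1%:R * r) * A = 48 * 64 * t.+1%:R ^+ 2 * r.
  by rewrite /A; ring.
rewrite mulrA ler_pdivrMr ?exprn_gt0 //.
have T2 : t.+1%:R ^+ 2 <= 36 * ln (ln n%:R) ^+ 2 :> R.
  have -> : 36 * ln (ln n%:R) ^+ 2 = (6 * ln (ln n%:R)) ^+ 2 :> R by ring.
  apply: lerXn2r; rewrite ?nnegrE //.
  by rewrite mulr_ge0 // ltW.
have -> : gain_cst R / 48 / 64 / 36 * ln n%:R
  = gain_cst R * ln n%:R / (48 * 64) / 36 by field.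
rewrite ler_pdivrMr // ler_pdivrMr ?mulr_gt0 //.
apply: le_trans key _.
have -> : r * ln (ln n%:R) ^+ 2 * 36 * (48 * 64)
  = (48 * 64) * (36 * ln (ln n%:R) ^+ 2) * r by ring.
by rewrite ler_wpM2r // ler_wpM2l ?mulr_ge0.
Qed.
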